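(* Let $(\mathsf R(t),\mathsf N(t))$ and $(\mathscr R(t),\Phi(t))$ be the solutions on $[0,T]$ of the two Volterra systems in the context: $\mathsf R,\mathsf N$ are the deterministic equivalents of the least-squares risk and squared norm for adversarial homogenized SGD, and $\mathscr R,\Phi$ are those for homogenized SGD on $\ell_2$-regularized least squares with adaptive learning rate and adaptive regularization. Assume $\mathsf R(0)=\mathscr R(0)$ and $\mathsf N(0)=\Phi(0)$, and that for every $t\in[0,T]$ $$0<r_-\le\mathsf R(t),\mathscr R(t)\le r_+<\infty,\qquad 0<n_-\le\mathsf N(t),\Phi(t)\le n_+<\infty.$$ Then there is a constant $C=C(\|K\|_{op},\bar\gamma,T,r_-,r_+,n_-,n_+)$, independent of $d$, such that $$\sup_{0\le t\le T}\Big(|\mathsf R(t)-\mathscr R(t)|+|\mathsf N(t)-\Phi(t)|\Big)\le C\,\delta^2\Big(\frac12-\frac1\pi\Big).$$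
   Context: Least squares with a single centered Gaussian class: $K\in\mathbb R^{d\times d}$ symmetric positive semidefinite, $X_0,X^\star\in\mathbb R^d$, with $\|K\|_{op},\|X_0\|,\|X^\star\|$ bounded independently of $d$; $\delta>0$ (adversarial radius) and $\eta\ge0$ (noise standard deviation) are fixed; the learning rate $\gamma:\mathbb R_+\to\mathbb R_+$ is continuous and bounded by $\bar\gamma$. For a vector $u$, $\langle K,u^{\otimes2}\rangle=u^\top Ku$. For a pair of positive functions $(R,N)$ on $[0,T]$ put $$\gamma_{R,N}(t)=\gamma(t)\Big(1+\delta\sqrt{\tfrac2\pi}\sqrt{\tfrac{N(t)}{2R(t)}}\Big),\quad \lambda_{R,N}(t)=\frac{\delta^2+\delta\sqrt{2/\pi}\sqrt{2R(t)/N(t)}}{1+\delta\sqrt{2/\pi}\sqrt{N(t)/(2R(t))}},$$ $\tilde\Gamma(t)=\int_0^t\gamma_{R,N}(s)ds$, $\Lambda(t)=\int_0^t\gamma_{R,N}(s)\lambda_{R,N}(s)ds$ and $$m(t)=e^{-K\tilde\Gamma(t)-\Lambda(t)}\Big(X_0+\Big(\int_0^tK\gamma_{R,N}(s)e^{K\tilde\Gamma(s)+\Lambda(s)}ds\Big)X^\star\Big).$$ For a forcing function $\mathcal F(t)$ (depending on $R(t),N(t)$), the Volterra system with forcing $\mathcal F$ is $$R(t)=\tfrac12\langle K,(m(t)-X^\star)^{\otimes2}\rangle+\tfrac{\eta^2}2+\frac1d\int_0^t\gamma^2(s)\mathcal F(s)\operatorname{Tr}\big(K^2e^{-2K(\tilde\Gamma(t)-\tilde\Gamma(s))-2(\Lambda(t)-\Lambda(s))}\big)ds,$$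 $$N(t)=\|m(t)\|^2+\frac2d\int_0^t\gamma^2(s)\mathcal F(s)\operatorname{Tr}\big(Ke^{-2K(\tilde\Gamma(t)-\tilde\Gamma(s))-2(\Lambda(t)-\Lambda(s))}\big)ds.$$ The pair $(\mathsf R,\mathsf N)$ (in the paper $\mathsf N=\widehat{\mathsf B}_{44}$) solves it with the adversarial risk forcing $\mathcal F=R+\delta\sqrt{\tfrac2\pi}\sqrt{2RN}+\tfrac{\delta^2}2N$. The pair $(\mathscr R,\Phi)$ solves it (with $\tilde\Gamma,\Lambda,m$ computed from $(\mathscr R,\Phi)$) with forcing $\mathcal F=R+\delta\sqrt{\tfrac2\pi}\sqrt{2RN}+\tfrac{\delta^2}\pi N$. *)

(* Defs.v *)
From HB Require Import structures.
From mathcomp Require Import all_boot all_order all_algebra.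
From mathcomp Require Import all_classical all_reals all_analysis.

Set Implicit Arguments.
Unset Strict Implicit.
Unset Printing Implicit Defensive.

Import Order.TTheory GRing.Theory Num.Theory.
Import numFieldNormedType.Exports.

Local Open Scope classical_set_scope.
Local Open Scope ring_scope.

(* <K, u (x) u> *)
Definition qform (R : realType) (d : nat) (K : 'M[R]_d) (u : 'cV[R]_d) : R :=
  (u^T *m K *m u) 0 0.

(* The norm `|u| that the library puts on matrices is the sup norm, hence this
   Euclidean one. *)
Definition enorm (R : realType) (d : nat) (u : 'cV[R]_d) : R :=
  Num.sqrt (\sum_(i < d) u i 0 ^+ 2).

Definition opnorm (R : realType) (d : nat) (K : 'M[R]_d) : R :=
  sup [set enorm (K *m u) | u in [set u : 'cV[R]_d | enorm u <= 1]].

Definition sym_psd (R : realType) (d : nat) (K : 'M[R]_d) : Prop :=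
  K^T = K /\ forall u : 'cV[R]_d, 0 <= qform K u.

(* Matrix exponential: the sum of A^k / k!, the series converging entrywise. *)
Definition expmx (R : realType) (d : nat) (A : 'M[R]_d) : 'M[R]_d :=
  \matrix_(i, j) limn (series (fun k : nat => (k`!%:R^-1 *: A ^+ k) i j)).

Definition integral0 (R : realType) (f : R -> R) (t : R) : R :=
  \int[@lebesgue_measure R]_(s in `[0, t]) f s.

Definition integral0_mx (R : realType) (d : nat) (f : R -> 'M[R]_d) (t : R) :
    'M[R]_d :=
  \matrix_(i, j) integral0 (fun s => f s i j) t.

(* Below, r and n are the two unknowns R(t) and N(t) of the Volterra system. *)

Definition eff_rate (R : realType) (delta : R) (gamma r n : R -> R) (t : R) : R :=
  gamma t * (1 + delta * Num.sqrt (2 / pi) * Num.sqrt (n t / (2 * r t))).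

Definition eff_reg (R : realType) (delta : R) (r n : R -> R) (t : R) : R :=
  (delta ^+ 2 + delta * Num.sqrt (2 / pi) * Num.sqrt (2 * r t / n t)) /
  (1 + delta * Num.sqrt (2 / pi) * Num.sqrt (n t / (2 * r t))).

Definition int_rate (R : realType) (delta : R) (gamma r n : R -> R) : R -> R :=
  integral0 (eff_rate delta gamma r n).

Definition int_reg (R : realType) (delta : R) (gamma r n : R -> R) : R -> R :=
  integral0 (fun s => eff_rate delta gamma r n s * eff_reg delta r n s).

(* m(t); in the exponents the scalar Lambda stands for Lambda times the
   identity matrix. *)
Definition mean_iterate (R : realType) (d : nat) (K : 'M[R]_d)
    (X0 Xstar : 'cV[R]_d) (delta : R) (gamma r n : R -> R) (t : R) : 'cV[R]_d :=
  let Gam := int_rate delta gamma r n in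
  let Lam := int_reg delta gamma r n in
  expmx (- (Gam t *: K) - (Lam t)%:M) *m
  (X0 +
   integral0_mx (fun s => eff_rate delta gamma r n s *:
                   (K *m expmx (Gam s *: K + (Lam s)%:M))) t *m Xstar).

(* exp(- 2 K (Gamma(t) - Gamma(s)) - 2 (Lambda(t) - Lambda(s))) *)
Definition decay (R : realType) (d : nat) (K : 'M[R]_d)
    (delta : R) (gamma r n : R -> R) (t s : R) : 'M[R]_d :=
  let Gam := int_rate delta gamma r n in
  let Lam := int_reg delta gamma r n in
  expmx (- (2 * (Gam t - Gam s)) *: K - (2 * (Lam t - Lam s))%:M).

(* Measurability is all that is needed for the integrals to make sense. *)
Record volterra_solution (R : realType) (d : nat) (K : 'M[R]_d)
    (X0 Xstar : 'cV[R]_d) (delta eta : R) (gamma : R -> R) (T : R)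
    (forcing : R -> R -> R) (r n : R -> R) : Prop := VolterraSolution {
  volterra_meas_r : measurable_fun `[0, T] r ;
  volterra_meas_n : measurable_fun `[0, T] n ;
  volterra_pos : forall t, 0 <= t <= T -> 0 < r t /\ 0 < n t ;
  volterra_eq_r : forall t, 0 <= t <= T ->
    r t = 2^-1 * qform K (mean_iterate K X0 Xstar delta gamma r n t - Xstar)
        + eta ^+ 2 / 2
        + d%:R^-1 * integral0 (fun s => gamma s ^+ 2 * forcing (r s) (n s) *
                      \tr (K ^+ 2 *m decay K delta gamma r n t s)) t ;
  volterra_eq_n : forall t, 0 <= t <= T ->
    n t = enorm (mean_iterate K X0 Xstar delta gamma r n t) ^+ 2
        + 2 / d%:R * integral0 (fun s => gamma s ^+ 2 * forcing (r s) (n s) *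
                      \tr (K *m decay K delta gamma r n t s)) t }.

Definition forcing_adv (R : realType) (delta r n : R) : R :=
  r + delta * Num.sqrt (2 / pi) * Num.sqrt (2 * r * n) + delta ^+ 2 / 2 * n.

Definition forcing_reg (R : realType) (delta r n : R) : R :=
  r + delta * Num.sqrt (2 / pi) * Num.sqrt (2 * r * n) + delta ^+ 2 / pi * n.

(* Main.v *)
(* The difference of the two systems is controlled by Gronwall's inequality.
   Diagonalizing K turns every matrix expression into a weighted sum, over the
   eigenvalues k of K, of the scalars
   exp(- k (Gamma t - Gamma s) - (Lambda t - Lambda s)) with values in [0, 1].
   On the box [rm, rp] x [nm, np] the effective rates and the forcings are
   Lipschitz functions of (r, n), except that the two forcings also differ by
   delta^2 (1/2 - 1/pi) n. Hence D t = |r t - r' t| + |n t - n' t| satisfies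
   D t <= Cb delta^2 (1/2 - 1/pi) + Ca \int_0^t D for delta <= 1. For delta > 1
   the claim is trivial, since D <= rp + np and delta^2 >= 1. The data X0 and
   Xstar enter only through |X0|^2 + <K, Xstar (x) Xstar>, which is bounded by
   the values of n and r at time 0. *)
Require Import Defs.
From HB Require Import structures.
From mathcomp Require Import all_boot all_order all_algebra.
From mathcomp Require Import all_classical all_reals all_analysis.
From mathcomp Require Import measurable_realfun complex ring lra.
Import Order.TTheory GRing.Theory Num.Theory.
Import numFieldNormedType.Exports.
(* mathcomp-analysis has a lemma integral0 that hides the one of Defs. *)
Import Defs.
Local Open Scope classical_set_scope.
Local Open Scope ring_scope.

Set Implicit Arguments.
Unset Strict Implicit.
Unset Printing Implicit Defensive.

(** * Real symmetric matrices *)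

Lemma ReD (R : rcfType) (x y : R[i]) : complex.Re (x + y) = complex.Re x + complex.Re y.
Proof. by case: x y => [a b] [c e]. Qed.

Lemma ImD (R : rcfType) (x y : R[i]) : complex.Im (x + y) = complex.Im x + complex.Im y.
Proof. by case: x y => [a b] [c e]. Qed.

Lemma Re_sum (R : rcfType) (I : finType) (F : I -> R[i]) :
  complex.Re (\sum_i F i) = \sum_i complex.Re (F i).
Proof. exact: (big_morph _ (@ReD R) erefl). Qed.

Lemma Im_sum (R : rcfType) (I : finType) (F : I -> R[i]) :
  complex.Im (\sum_i F i) = \sum_i complex.Im (F i).
Proof. exact: (big_morph _ (@ImD R) erefl). Qed.

Lemma symmetric_diagonalization (R : rcfType) (d : nat) (K : 'M[R]_d) :
  K^T = K ->
  exists (m : nat) (W : 'M[R]_(m, d)) (k : 'rV[R]_m),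
    W^T *m W = 1%:M /\ W *m K = diag_mx k *m W.
Proof.
move=> Ksym.
pose A : 'M[R[i]]_d := map_mx (real_complex R) K.
have Areal : A \is a realmx.
  by apply/mxOverP => i j; rewrite mxE; apply/complex_realP; exists (K i j).
have Asym : A \is symmetricmx.
  apply/is_hermitianmxP; rewrite expr0 scale1r.
  by apply/matrixP => i j; rewrite !mxE /= -[in LHS]Ksym mxE.
have Aherm := realsym_hermsym Asym Areal.
have spreal := hermitian_spectral_diag_real Aherm.
have Uu := spectral_unitarymx A.
have /orthomx_spectralP AE := hermitian_normalmx Aherm.
set U := spectralmx A in Uu AE.
set sp := spectral_diag A in spreal AE.
have UA : U *m A = diag_mx sp *m U.
  by rewrite [in LHS]AE !mulmxA mulmxV ?mul1mx// unitarymx_unit.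
have UU : map_mx conjc U^T *m U = 1%:M.
  by have := mulVmx (unitarymx_unit Uu); rewrite invmx_unitary.
exists (d + d)%N, (col_mx (map_mx (@complex.Re R) U) (map_mx (@complex.Im R) U)),
  (row_mx (map_mx (@complex.Re R) sp) (map_mx (@complex.Re R) sp)).
have spE j : sp 0 j = (complex.Re (sp 0 j))%:C%C.
  by rewrite RRe_real//; exact/mxOverP.
have UAE j b : \sum_a U j a * (K a b)%:C%C = (complex.Re (sp 0 j))%:C%C * U j b.
  have /matrixP/(_ j b) := UA; rewrite mul_diag_mx !mxE -spE => <-.
  by apply: eq_bigr => a _; rewrite mxE.
split.
  rewrite tr_col_mx mul_row_col; apply/matrixP => a b.
  have /matrixP/(_ a b)/(congr1 (@complex.Re R)) := UU.
  rewrite !mxE Re_sum -big_split/= => h.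
  transitivity (complex.Re (((a == b)%:R : R[i]))); last by case: eqP.
  rewrite -h.
  apply: eq_bigr => j _; rewrite !mxE; case: (U j a) (U j b) => [x y] [z w] /=.
  by ring.
rewrite mul_col_mx diag_mx_row mul_block_col !mul0mx addr0 add0r.
congr col_mx; apply/matrixP => j b; rewrite mul_diag_mx !mxE.
  have /(congr1 (@complex.Re R)) := UAE j b; rewrite Re_sum => h.
  transitivity (complex.Re ((complex.Re (sp 0 j))%:C%C * U j b)).
    rewrite -h; apply: eq_bigr => a _; rewrite mxE; case: (U j a) => [x y] /=.
    by ring.
  by case: (U j b) => [x y] /=; ring.
have /(congr1 (@complex.Im R)) := UAE j b; rewrite Im_sum => h.
transitivity (complex.Im ((complex.Re (sp 0 j))%:C%C * U j b)).
  rewrite -h; apply: eq_bigr => a _; rewrite mxE; case: (U j a) => [x y] /=.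
  by ring.
by case: (U j b) => [x y] /=; ring.
Qed.

(* Below, W stacks the real and imaginary parts of a complex unitary diagonalization of
   K: it is a 2d x d isometry rather than an orthogonal matrix, which spares a
   real spectral theorem. *)
Record eigenframe (R : realType) (m d : nat) (K : 'M[R]_d) (W : 'M[R]_(m, d))
    (k : 'rV[R]_m) : Prop := Eigenframe {
  frame_sym : K^T = K ;
  frame_isometry : W^T *m W = 1%:M ;
  frame_eigen : W *m K = diag_mx k *m W }.

Definition fcalc (R : realType) (m d : nat) (W : 'M[R]_(m, d)) (k : 'rV[R]_m)
  (f : R -> R) : 'M[R]_d := W^T *m diag_mx (map_mx f k) *m W.

Lemma eigenframe_decomp (R : realType) (m d : nat) (K : 'M[R]_d)
    (W : 'M[R]_(m, d)) (k : 'rV[R]_m) :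
  eigenframe K W k -> K = W^T *m diag_mx k *m W.
Proof. by move=> [Ks Wi We]; rewrite -mulmxA -We mulmxA Wi mul1mx. Qed.

Lemma qform_frame (R : realType) (m d : nat) (K : 'M[R]_d) (W : 'M[R]_(m, d))
    (k : 'rV[R]_m) (u : 'cV[R]_d) : eigenframe K W k ->
  qform K u = \sum_j k 0 j * (W *m u) j 0 ^+ 2.
Proof.
move=> /eigenframe_decomp KE; rewrite /qform KE !mulmxA -trmx_mul -!mulmxA.
rewrite mxE; apply: eq_bigr => j _; rewrite mul_diag_mx !mxE.
by rewrite expr2 mulrCA.
Qed.

Lemma enorm_frame (R : realType) (m d : nat) (W : 'M[R]_(m, d)) (u : 'cV[R]_d) :
  W^T *m W = 1%:M -> enorm u ^+ 2 = \sum_j (W *m u) j 0 ^+ 2.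
Proof.
move=> Wi; rewrite /enorm sqr_sqrtr; last by apply: sumr_ge0 => i _; exact: sqr_ge0.
transitivity ((u^T *m (W^T *m W) *m u) 0 0).
  by rewrite Wi mulmx1 mxE; apply: eq_bigr => i _; rewrite !mxE expr2.
rewrite !mulmxA -trmx_mul -mulmxA mxE.
by apply: eq_bigr => j _; rewrite !mxE expr2.
Qed.

Lemma opnorm_bounded (R : realType) (d : nat) (K : 'M[R]_d) :
  has_ubound [set enorm (K *m u) | u in [set u : 'cV[R]_d | enorm u <= 1]].
Proof.
exists (Num.sqrt (\sum_i (\sum_j `|K i j|) ^+ 2)) => y [u /= u1 <-].
rewrite /enorm ler_wsqrtr// ler_sum// => i _.
rewrite -[leLHS]real_normK ?num_real// lerXn2r ?nnegrE//; first exact: sumr_ge0.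
rewrite mxE (le_trans (ler_norm_sum _ _ _))// ler_sum// => j _.
rewrite normrM ler_piMr// (le_trans _ u1)// /enorm.
rewrite -sqrtr_sqr ler_wsqrtr// (bigD1 j)//= lerDl.
by apply: sumr_ge0 => l _; exact: sqr_ge0.
Qed.

Lemma enorm_eq0 (R : realType) (d : nat) (u : 'cV[R]_d) :
  enorm u = 0 -> u = 0.
Proof.
move=> /eqP; rewrite /enorm sqrtr_eq0 => h.
have {}h : \sum_i u i 0 ^+ 2 == 0.
  by rewrite eq_le h sumr_ge0// => i _; exact: sqr_ge0.
rewrite psumr_eq0 in h; last by move=> i _; exact: sqr_ge0.
apply/matrixP => i j; rewrite ord1 mxE; apply/eqP.
by have /allP/(_ i (mem_index_enum _)) := h; rewrite sqrf_eq0.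
Qed.

Lemma enormZ (R : realType) (d : nat) (a : R) (u : 'cV[R]_d) :
  enorm (a *: u) = `|a| * enorm u.
Proof.
rewrite /enorm -sqrtr_sqr -sqrtrM ?sqr_ge0//; congr Num.sqrt.
by rewrite mulr_sumr; apply: eq_bigr => i _; rewrite mxE exprMn.
Qed.

Lemma enorm_ge0 (R : realType) (d : nat) (u : 'cV[R]_d) : 0 <= enorm u.
Proof. exact: sqrtr_ge0. Qed.

Lemma eigenvalue_bounds (R : realType) (d : nat) (K : 'M[R]_d) (u : 'cV[R]_d) (a : R) :
  sym_psd K -> u != 0 -> K *m u = a *: u -> 0 <= a <= opnorm K.
Proof.
move=> [_ Kpsd] u0 Kua.
have nu0 : 0 < enorm u.
  rewrite lt_neqAle enorm_ge0 andbT eq_sym.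
  by apply: contra u0 => /eqP/enorm_eq0/eqP.
have a0 : 0 <= a.
  have := Kpsd u; rewrite /qform -mulmxA Kua -scalemxAr mxE.
  rewrite (_ : (u^T *m u) 0 0 = enorm u ^+ 2); last first.
    by rewrite (enorm_frame (W := 1%:M)) ?trmx1 ?mulmx1// mxE; apply: eq_bigr => i _;
       rewrite mul1mx !mxE expr2.
  by rewrite pmulr_lge0// exprn_gt0.
rewrite a0 /=; apply: ub_le_sup; first exact: opnorm_bounded.
exists ((enorm u)^-1 *: u).
  by rewrite /= enormZ ger0_norm ?invr_ge0 ?(ltW nu0)// mulVf ?(gt_eqF nu0)//.
rewrite -scalemxAr Kua !enormZ !ger0_norm ?invr_ge0 ?(ltW nu0)//.
by rewrite mulrCA mulVf ?mulr1 ?gt_eqF.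
Qed.

(* Where a row of W vanishes, the eigenvalue is arbitrary and is reset to 0. *)
Lemma psd_eigenframe (R : realType) (d : nat) (K : 'M[R]_d) : sym_psd K ->
  exists (m : nat) (W : 'M[R]_(m, d)) (k : 'rV[R]_m),
    eigenframe K W k /\ forall j, 0 <= k 0 j <= opnorm K.
Proof.
move=> Kpsd; have Ksym : K^T = K by case: Kpsd.
have [m [W [k [WW WK]]]] := symmetric_diagonalization Ksym.
exists m, W, (\row_j if row j W == 0 then 0 else k 0 j).
have rowE j : row j W *m K = k 0 j *: row j W.
  by rewrite -row_mul WK mul_diag_mx; apply/matrixP => a b; rewrite !mxE.
split.
  split=> //; rewrite WK !mul_diag_mx; apply/matrixP => j b; rewrite !mxE.
  by case: eqP => // /rowP/(_ b); rewrite !mxE => ->; rewrite !mulr0.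
move=> j; rewrite mxE; case: ifPn => [_|Wj0].
  rewrite lexx/=.
  have o0 : enorm (0 : 'cV[R]_d) = 0.
    by rewrite -[0](scale0r 0) enormZ normr0 mul0r.
  apply: ub_le_sup; first exact: opnorm_bounded.
  by exists 0; rewrite /= ?mulmx0 o0.
apply: (@eigenvalue_bounds _ _ _ (row j W)^T) => //.
  by apply: contra Wj0 => /eqP h; rewrite -[row j W]trmxK h trmx0.
by rewrite -{1}Ksym -trmx_mul rowE; apply/matrixP => a b; rewrite !mxE.
Qed.

(** * Functional calculus *)

Lemma eigenframe_comm (R : realType) (m d : nat) (K : 'M[R]_d) (W : 'M[R]_(m, d))
    (k : 'rV[R]_m) (f : R -> R) : eigenframe K W k ->
  W *m W^T *m diag_mx (map_mx f k) = diag_mx (map_mx f k) *m (W *m W^T).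
Proof.
move=> [Ks Wi We].
have We' : K *m W^T = W^T *m diag_mx k.
  by rewrite -{1}Ks -trmx_mul We trmx_mul tr_diag_mx.
have h : W *m W^T *m diag_mx k = diag_mx k *m (W *m W^T).
  by rewrite -mulmxA -We' !mulmxA We.
apply/matrixP => i j; have /matrixP/(_ i j) := h.
rewrite !mul_mx_diag !mul_diag_mx !mxE => {}h.
have [->|kij] := eqVneq (k 0 i) (k 0 j); first by rewrite mulrC.
have -> : \sum_l W i l * W^T l j = 0; last by rewrite mulr0 mul0r.
move: h => /eqP; rewrite mulrC -subr_eq0 -mulrBl mulf_eq0 subr_eq0 eq_sym.
by rewrite (negbTE kij) => /eqP.
Qed.

Lemma mul_frame_fcalc (R : realType) (m d : nat) (K : 'M[R]_d) (W : 'M[R]_(m, d))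
    (k : 'rV[R]_m) (f : R -> R) : eigenframe K W k ->
  W *m fcalc W k f = diag_mx (map_mx f k) *m W.
Proof.
move=> fK; rewrite /fcalc !mulmxA (eigenframe_comm f fK) -!mulmxA.
by rewrite (frame_isometry fK) mulmx1.
Qed.

Lemma fcalcM (R : realType) (m d : nat) (K : 'M[R]_d) (W : 'M[R]_(m, d))
    (k : 'rV[R]_m) (f g : R -> R) : eigenframe K W k ->
  fcalc W k f *m fcalc W k g = fcalc W k (fun x => f x * g x).
Proof.
move=> fK; rewrite {1}/fcalc -mulmxA (mul_frame_fcalc g fK) /fcalc !mulmxA.
congr (_ *m W); rewrite -mulmxA; congr (_ *m _).
apply/matrixP => i j; rewrite mul_diag_mx !mxE.
by case: eqP => _; rewrite ?mulr0 ?mulr1n ?mulr0n ?mulr0.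
Qed.

Lemma fcalcE (R : realType) (m d : nat) (W : 'M[R]_(m, d)) (k : 'rV[R]_m)
    (f : R -> R) (a b : 'I_d) :
  fcalc W k f a b = \sum_j W j a * W j b * f (k 0 j).
Proof.
rewrite /fcalc -mulmxA mxE; apply: eq_bigr => j _.
by rewrite mul_diag_mx !mxE -mulrA [f _ * _]mulrC.
Qed.

Lemma fcalc_affine (R : realType) (m d : nat) (K : 'M[R]_d) (W : 'M[R]_(m, d))
    (k : 'rV[R]_m) (x y : R) : eigenframe K W k ->
  x *: K + y%:M = fcalc W k (fun a => x * a + y).
Proof.
move=> fK; rewrite {1}(eigenframe_decomp fK) -[y%:M]mul1mx -(frame_isometry fK).
apply/matrixP => a b; rewrite fcalcE mul_mx_scalar !mxE !mulr_sumr -big_split.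
apply: eq_bigr => j _ /=; rewrite mul_mx_diag !mxE; ring.
Qed.

Lemma fcalc_expr (R : realType) (m d : nat) (K : 'M[R]_d) (W : 'M[R]_(m, d))
    (k : 'rV[R]_m) (f : R -> R) (n : nat) : eigenframe K W k ->
  fcalc W k f ^+ n = fcalc W k (fun x => f x ^+ n).
Proof.
move=> fK; elim: n => [|n IH].
  rewrite expr0; apply/matrixP => a b; have /matrixP/(_ a b) := frame_isometry fK.
  rewrite fcalcE => h; rewrite -[LHS]h mxE.
  by apply: eq_bigr => j _; rewrite !mxE mulr1.
rewrite exprS IH -[LHS]/(_ *m _) (fcalcM _ _ fK).
by congr fcalc; apply/funext => x; rewrite exprS.
Qed.

Lemma expmx_fcalc (R : realType) (m d : nat) (K : 'M[R]_d) (W : 'M[R]_(m, d))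
    (k : 'rV[R]_m) (f : R -> R) : eigenframe K W k ->
  expmx (fcalc W k f) = fcalc W k (fun x => expR (f x)).
Proof.
move=> fK; apply/matrixP => a b; rewrite mxE fcalcE.
rewrite (_ : series _ =
    (fun N : nat => \sum_j (W j a * W j b * series (exp_coeff (f (k 0 j))) N))); last first.
  apply/funext => N; rewrite /series /=.
  under eq_bigr do rewrite (fcalc_expr _ _ fK) mxE fcalcE mulr_sumr.
  rewrite exchange_big /=; apply: eq_bigr => j _; rewrite mulr_sumr.
  by apply: eq_bigr => i _; rewrite /exp_coeff /= mulrCA; congr (_ * _); rewrite mulrC.
apply: cvg_lim => //; apply: cvg_big => [|j _]; first exact: add_continuous.
apply: cvgMl_tmp; exact: is_cvg_series_exp_coeff.
Qed.

Lemma trace_fcalc (R : realType) (m d : nat) (W : 'M[R]_(m, d)) (k : 'rV[R]_m)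
    (f : R -> R) :
  \tr (fcalc W k f) = \sum_j (\sum_a W j a ^+ 2) * f (k 0 j).
Proof.
rewrite /mxtrace; under eq_bigr do rewrite fcalcE.
rewrite exchange_big; apply: eq_bigr => j _ /=; rewrite mulr_suml.
by apply: eq_bigr => a _; rewrite expr2.
Qed.

Lemma frame_weight (R : realType) (m d : nat) (W : 'M[R]_(m, d)) :
  W^T *m W = 1%:M -> \sum_j \sum_a W j a ^+ 2 = d%:R.
Proof.
move=> WW; rewrite exchange_big /= -(mxtrace1 R d) -WW; apply: eq_bigr => a _.
by rewrite mxE; apply: eq_bigr => j _; rewrite mxE expr2.
Qed.

Lemma fcalc_id (R : realType) (m d : nat) (K : 'M[R]_d) (W : 'M[R]_(m, d))
    (k : 'rV[R]_m) : eigenframe K W k -> K = fcalc W k id.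
Proof.
by move=> fK; rewrite {1}(eigenframe_decomp fK) /fcalc map_mx_id.
Qed.

(** * Integrals of bounded measurable functions *)

Definition bounded_measurable (R : realType) (T : R) (f : R -> R) : Prop :=
  measurable_fun `[0, T] f /\
  exists M : R, forall s : R, 0 <= s <= T -> `|f s| <= M.

Lemma bm_le (R : realType) (T t : R) (f : R -> R) :
  t <= T -> bounded_measurable T f -> bounded_measurable t f.
Proof.
move=> tT [mf [M fM]]; split.
  by apply: measurable_funS mf => //; apply: subset_itvl; rewrite bnd_simp.
by exists M => s /andP[s0 st]; rewrite fM// s0 (le_trans st).
Qed.

Lemma bm_integrable (R : realType) (T : R) (f : R -> R) :
  bounded_measurable T f ->
  (@lebesgue_measure R).-integrable `[0, T] (EFin \o f).
Proof.
move=> [mf [M fM]]; apply: measurable_bounded_integrable => //.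
  by rewrite /= lebesgue_measure_itv /=; case: ifP => _; rewrite ?ltry.
exists M; split; first exact: num_real.
by move=> x Mx s /=; rewrite in_itv/= => sT; apply: le_trans (fM s sT) (ltW Mx).
Qed.

Lemma bm_cst (R : realType) (T c : R) : bounded_measurable T (fun=> c).
Proof. by split; [exact: measurable_cst | exists `|c|]. Qed.

Lemma bmD (R : realType) (T : R) (f g : R -> R) :
  bounded_measurable T f -> bounded_measurable T g ->
  bounded_measurable T (fun s => f s + g s).
Proof.
move=> [mf [M fM]] [mg [N gN]]; split; first exact: measurable_funD.
by exists (M + N) => s sT; rewrite (le_trans (ler_normD _ _))// lerD ?fM ?gN.
Qed.

Lemma bmM (R : realType) (T : R) (f g : R -> R) :
  bounded_measurable T f -> bounded_measurable T g ->
  bounded_measurable T (fun s => f s * g s).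
Proof.
move=> [mf [M fM]] [mg [N gN]]; split; first exact: measurable_funM.
by exists (M * N) => s sT; rewrite normrM ler_pM ?fM ?gN.
Qed.

Lemma bmN (R : realType) (T : R) (f : R -> R) :
  bounded_measurable T f -> bounded_measurable T (fun s => - f s).
Proof.
move=> [mf [M fM]]; split; first exact: measurableT_comp.
by exists M => s sT; rewrite normrN fM.
Qed.

Lemma bmB (R : realType) (T : R) (f g : R -> R) :
  bounded_measurable T f -> bounded_measurable T g ->
  bounded_measurable T (fun s => f s - g s).
Proof. by move=> bf bg; apply: bmD => //; exact: bmN. Qed.

Lemma bm_norm (R : realType) (T : R) (f : R -> R) :
  bounded_measurable T f -> bounded_measurable T (fun s => `|f s|).
Proof.
move=> [mf [M fM]]; split; first exact: measurableT_comp.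
by exists M => s sT; rewrite normr_id fM.
Qed.

Lemma bm_sum (R : realType) (T : R) (I : Type) (r : seq I) (f : I -> R -> R) :
  (forall i, bounded_measurable T (f i)) ->
  bounded_measurable T (fun s => \sum_(i <- r) f i s).
Proof.
move=> bf; elim: r => [|i r IH].
  by under eq_fun do rewrite big_nil; exact: bm_cst.
by under eq_fun do rewrite big_cons; exact: bmD.
Qed.

Lemma bm_expR (R : realType) (T : R) (f : R -> R) :
  bounded_measurable T f -> bounded_measurable T (fun s => expR (f s)).
Proof.
move=> [mf [M fM]]; split; first exact: measurableT_comp.
exists (expR M) => s sT; rewrite ger0_norm ?expR_ge0// ler_expR.
by rewrite (le_trans (ler_norm _))// fM.
Qed.

Lemma bm_integral0 (R : realType) (T : R) (f : R -> R) :
  bounded_measurable T f -> bounded_measurable T (integral0 f).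
Proof.
move=> bf.
have [T0|T0] := ltP T 0.
  split; first by rewrite set_itv_ge ?bnd_simp -?ltNge//; exact: measurable_fun_set0.
  by exists 0 => s /andP[s0 /(le_trans s0)]; rewrite leNgt T0.
have cf : {within `[0, T], continuous (integral0 f)}.
  exact: parameterized_integral_continuous (bm_integrable bf).
split; first exact: subspace_continuous_measurable_fun.
have /compact_bounded[M [_ HM]] : compact (integral0 f @` `[0, T]).
  by apply: continuous_compact => //; exact: segment_compact.
exists (M + 1) => s sT; apply: (HM (M + 1)); first by rewrite ltrDl.
by exists s => //=; rewrite in_itv.
Qed.

Lemma bmV (R : realType) (T c : R) (f : R -> R) : 0 < c ->
  (forall s, 0 <= s <= T -> c <= f s) ->
  bounded_measurable T f -> bounded_measurable T (fun s => (f s)^-1).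
Proof.
move=> c0 cf [mf _]; split.
  apply: (@eq_measurable_fun _ _ _ _ _ (fun s => f s `^ (-1))).
    move=> s; rewrite inE/= in_itv/= => /cf /(lt_le_trans c0)/ltW f0.
    by rewrite powR_inv1.
  exact: (measurableT_comp (measurable_powR (-1))).
exists c^-1 => s sT; have fs := lt_le_trans c0 (cf s sT).
by rewrite ger0_norm ?invr_ge0 ?(ltW fs)// lef_pV2 ?posrE// cf.
Qed.

Lemma bm_sqrt (R : realType) (T : R) (f : R -> R) :
  bounded_measurable T f -> bounded_measurable T (fun s => Num.sqrt (f s)).
Proof.
move=> [mf [M fM]]; split.
  apply: measurableT_comp mf; apply: continuous_measurable_fun.
  exact: sqrt_continuous.
exists (Num.sqrt M) => s sT; rewrite ger0_norm ?sqrtr_ge0// ler_wsqrtr//.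
by rewrite (le_trans (ler_norm _))// fM.
Qed.

Lemma integral0_at0 (R : realType) (f : R -> R) : integral0 f 0 = 0.
Proof. by rewrite /integral0 set_itv1 Rintegral_set1. Qed.

Lemma eq_integral0 (R : realType) (f g : R -> R) (t : R) :
  (forall s, 0 <= s <= t -> f s = g s) -> integral0 f t = integral0 g t.
Proof.
by move=> fg; apply: eq_Rintegral => s; rewrite inE/= in_itv/=; exact: fg.
Qed.

Lemma integral0D (R : realType) (f g : R -> R) (t : R) :
  bounded_measurable t f -> bounded_measurable t g ->
  integral0 (fun s => f s + g s) t = integral0 f t + integral0 g t.
Proof. by move=> /bm_integrable bf /bm_integrable bg; exact: RintegralD. Qed.

Lemma integral0B (R : realType) (f g : R -> R) (t : R) :
  bounded_measurable t f -> bounded_measurable t g ->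
  integral0 (fun s => f s - g s) t = integral0 f t - integral0 g t.
Proof. by move=> /bm_integrable bf /bm_integrable bg; exact: RintegralB. Qed.

Lemma integral0Z (R : realType) (c : R) (f : R -> R) (t : R) :
  bounded_measurable t f ->
  integral0 (fun s => c * f s) t = c * integral0 f t.
Proof. by move=> /bm_integrable bf; exact: RintegralZl. Qed.

Lemma integral0_sum (R : realType) (I : Type) (r : seq I) (f : I -> R -> R) (t : R) :
  (forall i, bounded_measurable t (f i)) ->
  integral0 (fun s => \sum_(i <- r) f i s) t = \sum_(i <- r) integral0 (f i) t.
Proof.
move=> bf; elim: r => [|i r IH].
  rewrite big_nil (@eq_integral0 _ _ (fun s => 0 * 0)).
    by rewrite integral0Z ?mul0r//; exact: bm_cst.
  by move=> s _; rewrite big_nil mul0r.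
rewrite big_cons -IH -integral0D//; last exact: bm_sum.
by apply: eq_integral0 => s _; rewrite big_cons.
Qed.

Lemma integral0_cst (R : realType) (c t : R) :
  0 <= t -> integral0 (fun=> c) t = c * t.
Proof.
move=> t0; rewrite /integral0 Rintegral_cst//= lebesgue_measure_itv/= lte_fin.
case: ltP => [_|t_le0] /=; first by rewrite subr0.
by rewrite (@le_anti _ _ t 0) ?t0 ?t_le0// mulr0.
Qed.

Lemma le_integral0 (R : realType) (f g : R -> R) (t : R) :
  bounded_measurable t f -> bounded_measurable t g ->
  (forall s, 0 <= s <= t -> f s <= g s) -> integral0 f t <= integral0 g t.
Proof.
move=> /bm_integrable bf /bm_integrable bg fg; exact: le_Rintegral.
Qed.

Lemma integral0_incr_ge0 (R : realType) (f : R -> R) (s t : R) :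
  0 <= s <= t -> bounded_measurable t f ->
  (forall u, 0 <= u <= t -> 0 <= f u) -> integral0 f s <= integral0 f t.
Proof.
move=> /andP[s0 st] /bm_integrable bf f0; rewrite -subr_ge0 /integral0.
rewrite Rintegral_itvB ?bnd_simp//; apply: Rintegral_ge0 => u /=.
by rewrite in_itv/= => /andP[su ut]; rewrite f0// ut (le_trans s0 (ltW su)).
Qed.

Lemma le_integral0_norm (R : realType) (f : R -> R) (t : R) :
  bounded_measurable t f -> `|integral0 f t| <= integral0 (fun s => `|f s|) t.
Proof. by move=> /bm_integrable bf; exact: le_normr_Rintegral. Qed.

Lemma integral0_incr_norm (R : realType) (f : R -> R) (s t : R) :
  0 <= s <= t -> bounded_measurable t f ->
  `|integral0 f t - integral0 f s| <= integral0 (fun u => `|f u|) t.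
Proof.
move=> st bf; have [s0 st'] := andP st.
have bs := bm_le st' bf.
have bn := bm_norm bf.
have ns0 : 0 <= integral0 (fun u => `|f u|) s by exact: Rintegral_ge0.
have h1 : integral0 (fun u => `|f u| - f u) s <= integral0 (fun u => `|f u| - f u) t.
  by apply: integral0_incr_ge0 => //; [exact: bmB|move=> u _; rewrite subr_ge0 ler_norm].
have h2 : integral0 (fun u => `|f u| + f u) s <= integral0 (fun u => `|f u| + f u) t.
  apply: integral0_incr_ge0 => //; first exact: bmD.
  by move=> u _; have := ler_norm (- f u); rewrite normrN; lra.
move: h1 h2; rewrite !integral0B ?integral0D//; [|exact: bm_norm|exact: bm_norm].
by move=> h1 h2; rewrite ler_norml; apply/andP; split; lra.
Qed.

Lemma integral0_expR_le (R : realType) (L t : R) : 0 < L -> 0 <= t ->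
  integral0 (fun s => expR (L * s)) t <= expR (L * t) / L.
Proof.
move=> L0; rewrite le_eqVlt => /predU1P[<-|t0].
  by rewrite integral0_at0 divr_ge0 ?expR_ge0// ltW.
have cexp : continuous (fun s => expR (L * s)).
  move=> x; apply: continuous_comp; last exact: continuous_expR.
  exact: mulrl_continuous.
rewrite /integral0 /Rintegral (@continuous_FTC2 _ _ (fun s => expR (L * s) / L))//.
- by rewrite mulr0 expR0 /= gerBl divr_ge0// ltW.
- by apply: continuous_subspaceT => x; exact: cexp.
- have cF : continuous (fun s => expR (L * s) / L).
    by move=> x; apply: cvgMr_tmp; exact: cexp.
  split.
  + by move=> x _; exact: ex_derive.
  + by apply: cvg_at_right_filter; exact: cF.
  + by apply: cvg_at_left_filter; exact: cF.
- move=> x _; rewrite derive1E derive_val.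
  by rewrite /GRing.scale/= mulr0 add0r mulr1 mulrCA mulVf ?mulr1 ?gt_eqF.
Qed.

(* D is only measurable, so the usual differentiation argument is not available:
   compare with the supremum of D t exp(- 2 L t), using
   L \int_0^t exp(2 L s) ds <= exp(2 L t) / 2. *)
Lemma gronwall (R : realType) (T c L : R) (D : R -> R) :
  0 < L -> 0 <= c -> bounded_measurable T D ->
  (forall t, 0 <= t <= T -> 0 <= D t) ->
  (forall t, 0 <= t <= T -> D t <= c + L * integral0 D t) ->
  forall t, 0 <= t <= T -> D t <= 2 * c * expR (2 * L * T).
Proof.
move=> L0 c0 bD D0 DL t0 /andP[t00 t0T].
have T0 : 0 <= T by exact: le_trans t0T.
have L2 : 0 < 2 * L by lra.
pose w s := D s * expR (- (2 * L * s)).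
have wE s : D s = w s * expR (2 * L * s).
  by rewrite /w -mulrA -expRD addNr expR0 mulr1.
pose A := [set w s | s in `[0, T]].
have [_ [M DM]] := bD.
have Aub : has_ubound A.
  exists M => y [s /=]; rewrite in_itv/= => sT <-.
  have /andP[s0 _] := sT.
  apply: (le_trans _ (DM _ sT)); rewrite ger0_norm ?D0//.
  rewrite ler_piMr ?D0// -[leRHS]expR0 ler_expR oppr_le0.
  by rewrite mulr_ge0// ltW.
have Ain s : 0 <= s <= T -> w s <= sup A.
  by move=> sT; apply: ub_le_sup => //; exists s => //=; rewrite in_itv.
have S0 : 0 <= sup A.
  have T00 : (0 : R) <= 0 <= T by rewrite T0 lexx.
  by apply: le_trans (Ain 0 T00); rewrite /w mulr_ge0 ?expR_ge0// D0.
have half s : 0 <= s <= T -> w s <= c + sup A / 2.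
  move=> sT; have /andP[s0 sT'] := sT.
  have bDs := bm_le sT' bD.
  have bE : bounded_measurable s (fun u => expR (2 * L * u)).
    apply: bm_expR; apply: bmM; first exact: bm_cst.
    split; first exact: measurable_id.
    by exists s => u /andP[u0 us]; rewrite ger0_norm.
  have h1 : integral0 D s <= sup A * (expR (2 * L * s) / (2 * L)).
    apply: (@le_trans _ _ (integral0 (fun u => sup A * expR (2 * L * u)) s)).
      apply: le_integral0 => //; first by apply: bmM => //; exact: bm_cst.
      move=> u /andP[u0 us]; rewrite wE ler_wpM2r ?expR_ge0// Ain// u0.
      exact: le_trans sT'.
    by rewrite integral0Z// ler_wpM2l// integral0_expR_le.
  have e0 : 0 < expR (- (2 * L * s)) by exact: expR_gt0.
  have e1 : expR (- (2 * L * s)) <= 1.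
    by rewrite -[leRHS]expR0 ler_expR oppr_le0 mulr_ge0// ltW.
  have ee : expR (2 * L * s) * expR (- (2 * L * s)) = 1.
    by rewrite -expRD addrN expR0.
  apply: (@le_trans _ _ ((c + L * (sup A * (expR (2 * L * s) / (2 * L)))) *
                         expR (- (2 * L * s)))).
    rewrite /w ler_pM2r//; apply: le_trans (DL s sT) _.
    by rewrite lerD2l ler_pM2l.
  have -> : L * (sup A * (expR (2 * L * s) / (2 * L))) = sup A / 2 * expR (2 * L * s).
    by field; rewrite gt_eqF.
  rewrite mulrDl -[X in _ + X]mulrA ee mulr1 lerD2r.
  by rewrite ler_piMr.
have Sle : sup A <= 2 * c.
  have : sup A <= c + sup A / 2.
    apply: ge_sup; first by exists (w 0), 0 => //=; rewrite in_itv/= lexx.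
    by move=> y [s /=]; rewrite in_itv/= => sT <-; exact: half.
  lra.
rewrite wE; apply: ler_pM; rewrite ?expR_ge0//.
- by rewrite /w mulr_ge0 ?expR_ge0// D0// t00.
- by apply: le_trans Sle; apply: Ain; rewrite t00.
- by rewrite ler_expR ler_pM2l.
Qed.

(** * Eigenmodes of the Volterra system *)

Definition mode_decay (R : realType) (a b : R -> R) (k t s : R) : R :=
  expR (- (k * (integral0 a t - integral0 a s)) - (integral0 b t - integral0 b s)).

Definition mode_forcing (R : realType) (a b : R -> R) (k t : R) : R :=
  integral0 (fun s => a s * mode_decay a b k t s) t.

Lemma decay_fcalc (R : realType) (m d : nat) (K : 'M[R]_d) (W : 'M[R]_(m, d))
    (k : 'rV[R]_m) (delta : R) (gamma r n : R -> R) (t s : R) : eigenframe K W k ->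
  decay K delta gamma r n t s =
  fcalc W k (fun x => mode_decay (eff_rate delta gamma r n)
     (fun s => eff_rate delta gamma r n s * eff_reg delta r n s) x t s ^+ 2).
Proof.
move=> fK; rewrite /decay -(raddfN (@scalar_mx R d)) (fcalc_affine _ _ fK).
rewrite (expmx_fcalc _ fK); congr fcalc; apply/funext => x.
rewrite /mode_decay -expRM_natl /int_rate /int_reg; congr expR; ring.
Qed.

Lemma mean_iterate_mode (R : realType) (m d : nat) (K : 'M[R]_d)
    (W : 'M[R]_(m, d)) (k : 'rV[R]_m) (X0 Xstar : 'cV[R]_d) (delta : R)
    (gamma r n : R -> R) (t : R) (a := eff_rate delta gamma r n)
    (b := fun s => eff_rate delta gamma r n s * eff_reg delta r n s) (j : 'I_m) :
  eigenframe K W k -> bounded_measurable t a -> bounded_measurable t b ->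
  (W *m mean_iterate K X0 Xstar delta gamma r n t) j 0 =
  mode_decay a b (k 0 j) t 0 * (W *m X0) j 0 +
  k 0 j * mode_forcing a b (k 0 j) t * (W *m Xstar) j 0.
Proof.
move=> fK ba bb; rewrite /mean_iterate.
have bE x : bounded_measurable t (fun s => a s * expR (integral0 a s * x + integral0 b s)).
  apply: bmM => //; apply: bm_expR; apply: bmD; last exact: bm_integral0.
  by apply: bmM; [exact: bm_integral0 | exact: bm_cst].
have -> : integral0_mx (fun s => eff_rate delta gamma r n s *:
    (K *m expmx (int_rate delta gamma r n s *: K + (int_reg delta gamma r n s)%:M))) t =
    fcalc W k (fun x => x * integral0 (fun s => a s * expR (integral0 a s * x + integral0 b s)) t).
  apply/matrixP => i l; rewrite mxE fcalcE.
  transitivity (integral0 (fun s => \sum_j (W j i * W j l * k 0 j) *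
      (a s * expR (integral0 a s * k 0 j + integral0 b s))) t).
    apply: eq_integral0 => s _; rewrite (fcalc_affine _ _ fK) (expmx_fcalc _ fK).
    rewrite {1}(fcalc_id fK) (fcalcM _ _ fK) mxE fcalcE mulr_sumr.
    by apply: eq_bigr => j' _; rewrite /a /b /int_rate /int_reg; ring.
  rewrite integral0_sum => [|j']; last by apply: bmM => //; exact: bm_cst.
  by apply: eq_bigr => j' _; rewrite integral0Z// mulrA.
rewrite -scaleNr -(raddfN (@scalar_mx R d)) (fcalc_affine _ _ fK).
rewrite (expmx_fcalc _ fK) mulmxA (mul_frame_fcalc _ fK) -mulmxA mulmxDr.
rewrite mulmxA (mul_frame_fcalc _ fK) -mulmxA mul_diag_mx mxE [X in _ * X]mxE mul_diag_mx.
rewrite !mxE /mode_forcing {1}/mode_decay !integral0_at0 !subr0.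
rewrite -/a -/b mulNr [_ * k 0 j]mulrC.
set e := expR (- _ - _).
have -> : integral0 (fun s => a s * mode_decay a b (k 0 j) t s) t =
    e * integral0 (fun s => a s * expR (integral0 a s * k 0 j + integral0 b s)) t.
  rewrite -integral0Z//; apply: eq_integral0 => s _.
  by rewrite mulrCA /mode_decay -expRD; congr (_ * expR _); ring.
by ring.
Qed.

Lemma expR_lipschitz (R : realType) (x y : R) : x <= 0 -> y <= 0 ->
  `|expR x - expR y| <= `|x - y|.
Proof.
have h (u v : R) : u <= v -> v <= 0 -> expR v - expR u <= v - u.
  move=> uv v0; have -> : expR v - expR u = expR v * (1 - expR (u - v)).
    by rewrite mulrBr mulr1 -expRD subrKC.
  have e1 : expR v <= 1 by rewrite -[leRHS]expR0 ler_expR.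
  have e2 : 1 + (u - v) <= expR (u - v) by exact: expR_ge1Dx.
  have e3 : expR (u - v) <= 1 by rewrite -[leRHS]expR0 ler_expR; lra.
  apply: (@le_trans _ _ (1 * (1 - expR (u - v)))); last by lra.
  by rewrite ler_wpM2r// subr_ge0.
move=> x0 y0; have [xy|/ltW yx] := leP x y.
  by rewrite distrC ger0_norm ?subr_ge0 ?ler_expR// distrC ger0_norm ?subr_ge0// h.
by rewrite ger0_norm ?subr_ge0 ?ler_expR// ger0_norm ?subr_ge0// h.
Qed.

Lemma bm_mode_decay (R : realType) (a b : R -> R) (k t : R) :
  bounded_measurable t a -> bounded_measurable t b ->
  bounded_measurable t (mode_decay a b k t).
Proof.
move=> ba bb; apply: bm_expR; apply: bmB; last first.
  by apply: bmB; [exact: bm_cst | exact: bm_integral0].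
apply: bmN; apply: bmM; first exact: bm_cst.
by apply: bmB; [exact: bm_cst | exact: bm_integral0].
Qed.

Lemma mode_exponent_le0 (R : realType) (a b : R -> R) (k t s : R) :
  bounded_measurable t a -> bounded_measurable t b ->
  (forall u, 0 <= u <= t -> 0 <= a u) -> (forall u, 0 <= u <= t -> 0 <= b u) ->
  0 <= k -> 0 <= s <= t ->
  - (k * (integral0 a t - integral0 a s)) - (integral0 b t - integral0 b s) <= 0.
Proof.
move=> ba bb a0 b0 k0 st.
have ha : integral0 a s <= integral0 a t by exact: integral0_incr_ge0.
have hb : integral0 b s <= integral0 b t by exact: integral0_incr_ge0.
have : 0 <= k * (integral0 a t - integral0 a s) by rewrite mulr_ge0 ?subr_ge0.
by lra.
Qed.

Lemma mode_decay_bounds (R : realType) (a b : R -> R) (k t s : R) :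
  bounded_measurable t a -> bounded_measurable t b ->
  (forall u, 0 <= u <= t -> 0 <= a u) -> (forall u, 0 <= u <= t -> 0 <= b u) ->
  0 <= k -> 0 <= s <= t -> 0 <= mode_decay a b k t s <= 1.
Proof.
move=> ba bb a0 b0 k0 st; rewrite expR_ge0 -expR0 ler_expR.
exact: mode_exponent_le0.
Qed.

Lemma mode_decay_lipschitz (R : realType) (a b a' b' : R -> R) (k t s e : R) :
  bounded_measurable t a -> bounded_measurable t b ->
  bounded_measurable t a' -> bounded_measurable t b' ->
  (forall u, 0 <= u <= t -> 0 <= a u) -> (forall u, 0 <= u <= t -> 0 <= b u) ->
  (forall u, 0 <= u <= t -> 0 <= a' u) -> (forall u, 0 <= u <= t -> 0 <= b' u) ->
  integral0 (fun u => `|a u - a' u|) t <= e ->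
  integral0 (fun u => `|b u - b' u|) t <= e ->
  0 <= k -> 0 <= s <= t ->
  `|mode_decay a b k t s - mode_decay a' b' k t s| <= (k + 1) * e.
Proof.
move=> ba bb ba' bb' a0 b0 a'0 b'0 ea eb k0 st.
apply: le_trans (expR_lipschitz _ _) _; [exact: mode_exponent_le0..|].
have st' : s <= t by case/andP: st.
have ha := integral0_incr_norm st (bmB ba ba').
have hb := integral0_incr_norm st (bmB bb bb').
rewrite !integral0B// in ha hb; try exact: bm_le st' _.
rewrite [X in `|X|](_ : _ = - (k * (integral0 a t - integral0 a' t - (integral0 a s - integral0 a' s)))
  - (integral0 b t - integral0 b' t - (integral0 b s - integral0 b' s))); last by ring.
rewrite (le_trans (ler_normB _ _))// normrN mulrDl mul1r lerD//; last exact: le_trans eb.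
by rewrite normrM ger0_norm// ler_wpM2l// (le_trans ha).
Qed.

Lemma mode_forcing_bounds (R : realType) (a b : R -> R) (k t A : R) :
  bounded_measurable t a -> bounded_measurable t b ->
  (forall u, 0 <= u <= t -> 0 <= a u <= A) -> (forall u, 0 <= u <= t -> 0 <= b u) ->
  0 <= k -> 0 <= t -> 0 <= mode_forcing a b k t <= A * t.
Proof.
move=> ba bb aA b0 k0 t0.
have a0 u : 0 <= u <= t -> 0 <= a u by move=> /aA/andP[].
have bd := bm_mode_decay k ba bb.
have dd u : 0 <= u <= t -> 0 <= mode_decay a b k t u <= 1.
  by move=> ut; apply: mode_decay_bounds.
rewrite /mode_forcing; apply/andP; split.
  apply: Rintegral_ge0 => u /=; rewrite in_itv/= => ut.
  by rewrite mulr_ge0 ?a0//; case/andP: (dd _ ut).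
rewrite -integral0_cst//; apply: le_integral0; [exact: bmM|exact: bm_cst|].
move=> u ut; have /andP[d0 d1] := dd _ ut; have /andP[a0' aA'] := aA _ ut.
by rewrite -[leRHS]mulr1 ler_pM.
Qed.

Lemma integral0_prod_lipschitz (R : realType) (f g f' g' h : R -> R) (t B G q : R) :
  bounded_measurable t f -> bounded_measurable t g ->
  bounded_measurable t f' -> bounded_measurable t g' ->
  bounded_measurable t h -> 0 <= t ->
  (forall u, 0 <= u <= t -> `|f' u| <= B) -> (forall u, 0 <= u <= t -> `|g u| <= G) ->
  (forall u, 0 <= u <= t -> `|f u - f' u| <= h u) ->
  (forall u, 0 <= u <= t -> `|g u - g' u| <= q) ->
  `|integral0 (fun u => f u * g u) t - integral0 (fun u => f' u * g' u) t| <=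
  G * integral0 h t + B * q * t.
Proof.
move=> bf bg bf' bg' bh t0 fB gG fh gq.
have bfg := bmM bf bg; have bfg' := bmM bf' bg'.
rewrite -integral0B// (le_trans (le_integral0_norm (bmB bfg bfg')))//.
rewrite -integral0Z// -integral0_cst// -integral0D//; last 2 first.
- by apply: bmM => //; exact: bm_cst.
- exact: bm_cst.
apply: le_integral0.
- exact: bm_norm (bmB bfg bfg').
- by apply: bmD; [apply: bmM => //|]; exact: bm_cst.
move=> u ut; have -> : f u * g u - f' u * g' u = g u * (f u - f' u) + f' u * (g u - g' u).
  by ring.
by rewrite (le_trans (ler_normD _ _))// !normrM lerD// ler_pM// ?gG ?fh ?fB ?gq.
Qed.

Lemma mode_forcing_lipschitz (R : realType) (a b a' b' : R -> R) (k t A e : R) :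
  bounded_measurable t a -> bounded_measurable t b ->
  bounded_measurable t a' -> bounded_measurable t b' ->
  (forall u, 0 <= u <= t -> 0 <= a u) -> (forall u, 0 <= u <= t -> 0 <= b u) ->
  (forall u, 0 <= u <= t -> 0 <= a' u <= A) -> (forall u, 0 <= u <= t -> 0 <= b' u) ->
  integral0 (fun u => `|a u - a' u|) t <= e ->
  integral0 (fun u => `|b u - b' u|) t <= e ->
  0 <= k -> 0 <= t ->
  `|mode_forcing a b k t - mode_forcing a' b' k t| <= e + A * ((k + 1) * e) * t.
Proof.
move=> ba bb ba' bb' a0 b0 a'A b'0 ea eb k0 t0.
have a'0 u : 0 <= u <= t -> 0 <= a' u by move=> /a'A/andP[].
apply: le_trans (integral0_prod_lipschitz (h := fun u => `|a u - a' u|)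
  (B := A) (G := 1) (q := (k + 1) * e) ba (bm_mode_decay k ba bb) ba'
  (bm_mode_decay k ba' bb') (bm_norm (bmB ba ba')) t0 _ _ _ _) _ => //.
- by move=> u ut; have /andP[h1 h2] := a'A u ut; rewrite ger0_norm.
- move=> u ut; have /andP[h1 h2] := mode_decay_bounds ba bb a0 b0 k0 ut.
  by rewrite ger0_norm.
- by move=> u ut; exact: mode_decay_lipschitz.
- by rewrite mul1r lerD2r.
Qed.

Lemma mode_square_diff (R : realType) (kap B e g g' J J' k x y : R) :
  0 <= k <= kap -> 0 <= g <= 1 -> 0 <= g' <= 1 -> 0 <= J <= B -> 0 <= J' <= B ->
  `|g - g'| <= e -> `|J - J'| <= e ->
  `|(g * x + k * J * y) ^+ 2 - (g' * x + k * J' * y) ^+ 2| <=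
    4 * (1 + B) * (1 + kap) * e * (x ^+ 2 + k * y ^+ 2) /\
  `|k * (g * x + k * J * y - y) ^+ 2 - k * (g' * x + k * J' * y - y) ^+ 2| <=
    (4 * (1 + B) * (1 + kap) ^+ 2 + 3 * (1 + kap)) * e * (x ^+ 2 + k * y ^+ 2).
Proof.
move=> /andP[k0 kk] /andP[g0 g1] /andP[g'0 g'1] /andP[J0 JB] /andP[J'0 J'B] ge Je.
have e0 : 0 <= e by exact: le_trans ge.
have B0 : 0 <= B by exact: le_trans JB.
have kap0 : 0 <= kap by exact: le_trans kk.
set v := g * x + _; set v' := g' * x + _.
pose X := `|x|; pose Y := `|y|.
have X0 : 0 <= X by exact: normr_ge0.
have Y0 : 0 <= Y by exact: normr_ge0.
have X2 : x ^+ 2 = X ^+ 2 by rewrite real_normK ?num_real.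
have Y2 : y ^+ 2 = Y ^+ 2 by rewrite real_normK ?num_real.
have kY0 : 0 <= k * Y by exact: mulr_ge0.
pose S := X + k * Y; have S0 : 0 <= S by exact: addr_ge0.
pose Q := X ^+ 2 + k * Y ^+ 2.
have kY2 : 0 <= k * Y ^+ 2 by rewrite mulr_ge0 ?sqr_ge0.
have kkY2 : k ^+ 2 * Y ^+ 2 <= kap * (k * Y ^+ 2).
  by rewrite expr2 -mulrA ler_wpM2r.
have SQ : S ^+ 2 <= 2 * (1 + kap) * Q.
  have : 0 <= (X - k * Y) ^+ 2 by exact: sqr_ge0.
  have : 0 <= kap * X ^+ 2 by rewrite mulr_ge0 ?sqr_ge0.
  by rewrite /S /Q; nra.
have Q0 : 0 <= Q by rewrite addr_ge0 ?sqr_ge0.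
have kXY : 2 * (k * X * Y) <= (1 + kap) * Q.
  have : 0 <= k * (X - Y) ^+ 2 by rewrite mulr_ge0 ?sqr_ge0.
  have : k * X ^+ 2 <= kap * X ^+ 2 by rewrite ler_wpM2r ?sqr_ge0.
  have : 0 <= kap * (k * Y ^+ 2) by rewrite mulr_ge0.
  have := sqr_ge0 X.
  by rewrite /Q; nra.
have dv : `|v - v'| <= e * S.
  have -> : v - v' = (g - g') * x + k * ((J - J') * y) by rewrite /v /v'; ring.
  rewrite (le_trans (ler_normD _ _))// !normrM (ger0_norm k0) -/X -/Y.
  have h1 : `|g - g'| * X <= e * X by rewrite ler_wpM2r.
  have h2 : k * (`|J - J'| * Y) <= k * (e * Y) by rewrite ler_wpM2l// ler_wpM2r.
  by rewrite /S; lra.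
have bv w I : 0 <= w <= 1 -> 0 <= I <= B -> `|w * x + k * I * y| <= (1 + B) * S.
  move=> /andP[w0 w1] /andP[I0 IB].
  rewrite (le_trans (ler_normD _ _))// !normrM (ger0_norm k0) (ger0_norm w0) (ger0_norm I0).
  have h1 : w * X <= 1 * X by rewrite ler_wpM2r.
  have h2 : k * I * Y <= B * (k * Y) by rewrite -mulrA mulrCA ler_wpM2r.
  have h3 : 0 <= B * X by exact: mulr_ge0.
  by rewrite /S -/X -/Y; lra.
have bv1 : `|v| <= (1 + B) * S by apply: bv; rewrite ?g0 ?J0.
have bv2 : `|v'| <= (1 + B) * S by apply: bv; rewrite ?g'0 ?J'0.
have first : `|v ^+ 2 - v' ^+ 2| <= 4 * (1 + B) * (1 + kap) * e * Q.
  rewrite subr_sqr normrM.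
  apply: (@le_trans _ _ (e * S * (2 * (1 + B) * S))).
    rewrite ler_pM// (le_trans (ler_normD _ _))//; lra.
  rewrite (_ : e * S * _ = (2 * (1 + B) * e) * S ^+ 2); last by ring.
  rewrite (_ : 4 * _ * _ * e * Q = (2 * (1 + B) * e) * (2 * (1 + kap) * Q)); last by ring.
  by rewrite ler_wpM2l// !mulr_ge0// addr_ge0.
rewrite X2 Y2 -/Q; split=> //.
have -> : k * (v - y) ^+ 2 - k * (v' - y) ^+ 2 =
    k * (v ^+ 2 - v' ^+ 2) - 2 * (k * ((v - v') * y)) by ring.
rewrite (le_trans (ler_normB _ _))// !normrM (ger0_norm k0) -/Y [`|2|]ger0_norm//.
have h1 : k * `|v ^+ 2 - v' ^+ 2| <= kap * (4 * (1 + B) * (1 + kap) * e * Q).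
  exact: ler_pM.
have h2 : k * (`|v - v'| * Y) <= k * (e * S * Y) by rewrite ler_wpM2l// ler_wpM2r.
have h3 : 2 * (k * (e * S * Y)) <= e * (3 * (1 + kap) * Q).
  rewrite (_ : 2 * _ = e * (2 * (k * X * Y) + 2 * (k ^+ 2 * Y ^+ 2))); last by rewrite /S; ring.
  rewrite ler_wpM2l//.
  have : kap * (k * Y ^+ 2) <= kap * Q by rewrite ler_wpM2l// lerDr sqr_ge0.
  by lra.
have h4 : 0 <= 4 * (1 + B) * (1 + kap) * e * Q.
  by rewrite !mulr_ge0// addr_ge0.
by lra.
Qed.

Record nonneg_rates (R : realType) (t A : R) (a b : R -> R) : Prop := NonnegRates {
  nonneg_rates_bm_a : bounded_measurable t a ;
  nonneg_rates_bm_b : bounded_measurable t b ;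
  nonneg_rates_a : forall u, 0 <= u <= t -> 0 <= a u <= A ;
  nonneg_rates_b : forall u, 0 <= u <= t -> 0 <= b u }.

Lemma trace_mode_bm (R : realType) (m d : nat) (W : 'M[R]_(m, d)) (l : 'I_m -> R)
    (k : 'rV[R]_m) (t : R) (a b : R -> R) :
  bounded_measurable t a -> bounded_measurable t b ->
  bounded_measurable t (fun s => \sum_j (\sum_i W j i ^+ 2) *
                                 (l j * mode_decay a b (k 0 j) t s ^+ 2)).
Proof.
move=> ba bb; apply: bm_sum => j; have bd := bm_mode_decay (k 0 j) ba bb.
apply: bmM; first exact: bm_cst.
by apply: bmM; [exact: bm_cst | exact: bmM].
Qed.

Lemma trace_mode_bound (R : realType) (m d : nat) (W : 'M[R]_(m, d)) (l : 'I_m -> R)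
    (k : 'rV[R]_m) (Q t s A : R) (a b : R -> R) :
  W^T *m W = 1%:M -> (forall j, 0 <= l j <= Q) -> (forall j, 0 <= k 0 j) ->
  nonneg_rates t A a b -> 0 <= s <= t ->
  `|\sum_j (\sum_i W j i ^+ 2) * (l j * mode_decay a b (k 0 j) t s ^+ 2)| <= Q * d%:R.
Proof.
move=> WW lQ k0 [ba bb aA b0] st.
have a0 u : 0 <= u <= t -> 0 <= a u by move=> /aA/andP[].
rewrite -(frame_weight WW) mulr_sumr (le_trans (ler_norm_sum _ _ _))// ler_sum// => j _.
have w0 : 0 <= \sum_i W j i ^+ 2 by apply: sumr_ge0 => i _; exact: sqr_ge0.
have /andP[l0 lQj] := lQ j.
have /andP[p0 p1] := mode_decay_bounds ba bb a0 b0 (k0 j) st.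
rewrite normrM (ger0_norm w0) mulrC ler_wpM2r// ger0_norm ?mulr_ge0 ?sqr_ge0//.
by rewrite -[leRHS]mulr1 ler_pM ?sqr_ge0// expr_le1.
Qed.

Lemma trace_mode_lipschitz (R : realType) (m d : nat) (W : 'M[R]_(m, d)) (l : 'I_m -> R)
    (k : 'rV[R]_m) (Q t s A e kap : R) (a b a' b' : R -> R) :
  W^T *m W = 1%:M -> (forall j, 0 <= l j <= Q) -> (forall j, 0 <= k 0 j <= kap) ->
  nonneg_rates t A a b -> nonneg_rates t A a' b' ->
  integral0 (fun u => `|a u - a' u|) t <= e ->
  integral0 (fun u => `|b u - b' u|) t <= e -> 0 <= s <= t ->
  `|\sum_j (\sum_i W j i ^+ 2) * (l j * mode_decay a b (k 0 j) t s ^+ 2)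
    - \sum_j (\sum_i W j i ^+ 2) * (l j * mode_decay a' b' (k 0 j) t s ^+ 2)|
  <= Q * (2 * ((kap + 1) * e)) * d%:R.
Proof.
move=> WW lQ k0 [ba bb aA b0] [ba' bb' a'A b'0] ea eb st.
have a0 u : 0 <= u <= t -> 0 <= a u by move=> /aA/andP[].
have a'0 u : 0 <= u <= t -> 0 <= a' u by move=> /a'A/andP[].
have e0 : 0 <= e by apply: le_trans ea; exact: Rintegral_ge0.
rewrite -(frame_weight WW) mulr_sumr -sumrB (le_trans (ler_norm_sum _ _ _))// ler_sum// => j _.
have w0 : 0 <= \sum_i W j i ^+ 2 by apply: sumr_ge0 => i _; exact: sqr_ge0.
have /andP[l0 lQj] := lQ j; have /andP[kj0 kjk] := k0 j.
have /andP[p0 p1] := mode_decay_bounds ba bb a0 b0 kj0 st.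
have /andP[p'0 p'1] := mode_decay_bounds ba' bb' a'0 b'0 kj0 st.
have h := mode_decay_lipschitz ba bb ba' bb' a0 b0 a'0 b'0 ea eb kj0 st.
rewrite -mulrBr -mulrBr normrM (ger0_norm w0) mulrC ler_wpM2r//.
rewrite normrM (ger0_norm l0) ler_pM// subr_sqr normrM mulrC ler_pM//.
  by rewrite ger0_norm ?addr_ge0//; lra.
by rewrite (le_trans h)// ler_wpM2r// lerD2r.
Qed.

Lemma mean_terms_lipschitz (R : realType) (m d : nat) (K : 'M[R]_d)
    (W : 'M[R]_(m, d)) (k : 'rV[R]_m) (u v X0 Xstar : 'cV[R]_d)
    (t A e kap : R) (a b a' b' : R -> R)
    (x := fun j => (W *m X0) j 0) (y := fun j => (W *m Xstar) j 0)
    (e1 := (kap + 1) * e + e + A * ((kap + 1) * e) * t) :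
  eigenframe K W k -> (forall j, 0 <= k 0 j <= kap) ->
  nonneg_rates t A a b -> nonneg_rates t A a' b' ->
  integral0 (fun u => `|a u - a' u|) t <= e ->
  integral0 (fun u => `|b u - b' u|) t <= e -> 0 <= t ->
  (forall j, (W *m u) j 0 = mode_decay a b (k 0 j) t 0 * x j
     + k 0 j * mode_forcing a b (k 0 j) t * y j) ->
  (forall j, (W *m v) j 0 = mode_decay a' b' (k 0 j) t 0 * x j
     + k 0 j * mode_forcing a' b' (k 0 j) t * y j) ->
  `|enorm u ^+ 2 - enorm v ^+ 2| <= 4 * (1 + A * t) * (1 + kap) * e1 *
      (enorm X0 ^+ 2 + qform K Xstar) /\
  `|qform K (u - Xstar) - qform K (v - Xstar)| <=
      (4 * (1 + A * t) * (1 + kap) ^+ 2 + 3 * (1 + kap)) * e1 *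
      (enorm X0 ^+ 2 + qform K Xstar).
Proof.
move=> fK k0 [ba bb aA b0] [ba' bb' a'A b'0] ea eb t0 uE vE.
have WW := frame_isometry fK.
have a0 s : 0 <= s <= t -> 0 <= a s by move=> /aA/andP[].
have a'0 s : 0 <= s <= t -> 0 <= a' s by move=> /a'A/andP[].
have e0 : 0 <= e by apply: le_trans ea; exact: Rintegral_ge0.
have t0' : (0 : R) <= 0 <= t by rewrite lexx.
have A0 : 0 <= A by have /andP[h1 h2] := aA _ t0'; exact: le_trans h2.
have modes j := mode_square_diff (x j) (y j) (k0 j)
  (mode_decay_bounds ba bb a0 b0 (proj1 (andP (k0 j))) t0')
  (mode_decay_bounds ba' bb' a'0 b'0 (proj1 (andP (k0 j))) t0')
  (mode_forcing_bounds ba bb aA b0 (proj1 (andP (k0 j))) t0)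
  (mode_forcing_bounds ba' bb' a'A b'0 (proj1 (andP (k0 j))) t0).
have He j : `|mode_decay a b (k 0 j) t 0 - mode_decay a' b' (k 0 j) t 0| <= e1 /\
   `|mode_forcing a b (k 0 j) t - mode_forcing a' b' (k 0 j) t| <= e1.
  have /andP[kj0 kjk] := k0 j.
  have h1 := mode_decay_lipschitz ba bb ba' bb' a0 b0 a'0 b'0 ea eb kj0 t0'.
  have h2 := mode_forcing_lipschitz ba bb ba' bb' a0 b0 a'A b'0 ea eb kj0 t0.
  have h3 : (k 0 j + 1) * e <= (kap + 1) * e by rewrite ler_wpM2r// lerD2r.
  have h4 : A * ((k 0 j + 1) * e) * t <= A * ((kap + 1) * e) * t.
    by rewrite ler_wpM2r// ler_wpM2l.
  have h5 : 0 <= (k 0 j + 1) * e by rewrite mulr_ge0// addr_ge0.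
  have h6 : 0 <= A * ((k 0 j + 1) * e) * t by rewrite !mulr_ge0// addr_ge0.
  by rewrite /e1; split; lra.
have subE w j : (W *m (w - Xstar)) j 0 = (W *m w) j 0 - y j.
  by rewrite mulmxBr mxE [X in _ + X]mxE.
rewrite !(enorm_frame _ WW) !(qform_frame _ fK) -big_split !mulr_sumr -!sumrB.
split; apply: le_trans (ler_norm_sum _ _ _) _; apply: ler_sum => j _.
  by rewrite uE vE; have [h1 h2] := He j; have [] := modes _ j h1 h2.
by rewrite !subE uE vE; have [h1 h2] := He j; have [] := modes _ j h1 h2.
Qed.

Lemma volterra_term_lipschitz (R : realType) (m d : nat) (W : 'M[R]_(m, d))
    (l : 'I_m -> R) (k : 'rV[R]_m) (Q t A e kap B : R) (a b a' b' f f' h : R -> R)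
    (tr := fun a b s => \sum_j (\sum_i W j i ^+ 2) * (l j * mode_decay a b (k 0 j) t s ^+ 2)) :
  (0 < d)%N -> W^T *m W = 1%:M -> (forall j, 0 <= l j <= Q) ->
  (forall j, 0 <= k 0 j <= kap) ->
  nonneg_rates t A a b -> nonneg_rates t A a' b' ->
  integral0 (fun u => `|a u - a' u|) t <= e ->
  integral0 (fun u => `|b u - b' u|) t <= e -> 0 <= t ->
  bounded_measurable t f -> bounded_measurable t f' -> bounded_measurable t h ->
  (forall u, 0 <= u <= t -> `|f' u| <= B) ->
  (forall u, 0 <= u <= t -> `|f u - f' u| <= h u) ->
  `|d%:R^-1 * integral0 (fun s => f s * tr a b s) t
    - d%:R^-1 * integral0 (fun s => f' s * tr a' b' s) t|
  <= Q * (integral0 h t + 2 * B * (kap + 1) * e * t).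
Proof.
move=> d0 WW lQ k0 H H' ea eb t0 bf bf' bh fB fh.
have [ba bb aA b0] := H; have [ba' bb' a'A b'0] := H'.
have dR : 0 < d%:R :> R by rewrite ltr0n.
rewrite -mulrBr normrM ger0_norm ?invr_ge0 ?(ltW dR)// mulrC ler_pdivrMr//.
apply: le_trans (integral0_prod_lipschitz bf (trace_mode_bm W l k ba bb) bf'
  (trace_mode_bm W l k ba' bb') bh t0 fB _ fh _) _.
- move=> u ut; apply: (trace_mode_bound WW lQ _ H ut) => j.
  by have /andP[] := k0 j.
- by move=> u ut; apply: (trace_mode_lipschitz WW lQ k0 H H' ea eb ut).
- rewrite le_eqVlt; apply/orP; left; apply/eqP; ring.
Qed.

(** * Effective rates and forcings *)

Lemma sqrt_lipschitz (R : realType) (mu x y : R) : 0 < mu -> mu <= x -> mu <= y ->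
  `|Num.sqrt x - Num.sqrt y| <= (Num.sqrt mu)^-1 * `|x - y|.
Proof.
move=> mu0 mx my.
have s0 : 0 < Num.sqrt mu by rewrite sqrtr_gt0.
have x0 : 0 <= x by rewrite ltW// (lt_le_trans mu0).
have y0 : 0 <= y by rewrite ltW// (lt_le_trans mu0).
have -> : x - y = (Num.sqrt x - Num.sqrt y) * (Num.sqrt x + Num.sqrt y).
  by rewrite -subr_sqr !sqr_sqrtr.
rewrite normrM mulrCA ler_peMr// -(mulVf (lt0r_neq0 s0)) ler_pM2l ?invr_gt0//.
rewrite ger0_norm ?addr_ge0 ?sqrtr_ge0// ler_wpDr ?sqrtr_ge0//.
exact: ler_wsqrtr.
Qed.

Lemma sqrt_ratio_lipschitz (R : realType) (xm xp ym yp : R) :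
  0 < xm <= xp -> 0 < ym <= yp ->
  exists L B : R, [/\ 0 <= L, 0 <= B & forall x x' y y',
    xm <= x <= xp -> xm <= x' <= xp -> ym <= y <= yp -> ym <= y' <= yp ->
    Num.sqrt (x / y) <= B /\
    `|Num.sqrt (x / y) - Num.sqrt (x' / y')| <= L * (`|x - x'| + `|y - y'|)].
Proof.
move=> /andP[xm0 xmp] /andP[ym0 ymp].
have xp0 := lt_le_trans xm0 xmp; have yp0 := lt_le_trans ym0 ymp.
pose s := (Num.sqrt (xm / yp))^-1.
have s0 : 0 <= s by rewrite invr_ge0 sqrtr_ge0.
have L0 : 0 <= ym^-1 + xp / ym ^+ 2.
  by rewrite addr_ge0 ?invr_ge0 ?divr_ge0 ?sqr_ge0 ?ltW.
exists (s * (ym^-1 + xp / ym ^+ 2)), (Num.sqrt (xp / ym)); split.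
- exact: mulr_ge0.
- exact: sqrtr_ge0.
move=> x x' y y' /andP[x1 x2] /andP[x'1 x'2] /andP[y1 y2] /andP[y'1 y'2].
have y0 := lt_le_trans ym0 y1; have y'0 := lt_le_trans ym0 y'1.
have x0 := lt_le_trans xm0 x1; have x'0 := lt_le_trans xm0 x'1.
have iy : y^-1 <= ym^-1 by rewrite lef_pV2 ?posrE.
have iy' : y'^-1 <= ym^-1 by rewrite lef_pV2 ?posrE.
split.
  by apply: ler_wsqrtr; rewrite ler_pM ?invr_ge0 ?(ltW x0) ?(ltW y0).
have lo u v : xm <= u -> ym <= v -> v <= yp -> xm / yp <= u / v.
  move=> xu yv vy; have v0 := lt_le_trans ym0 yv.
  by rewrite ler_pM ?invr_ge0 ?(ltW xm0) ?(ltW yp0)// lef_pV2 ?posrE.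
apply: le_trans (sqrt_lipschitz (divr_gt0 xm0 yp0) (lo _ _ x1 y1 y2) (lo _ _ x'1 y'1 y'2)) _.
rewrite -mulrA ler_wpM2l//.
have -> : x / y - x' / y' = (x - x') * y^-1 - (y - y') * (x' * (y^-1 * y'^-1)).
  by field; rewrite !gt_eqF.
rewrite (le_trans (ler_normB _ _))// !normrM (gtr0_norm x'0).
rewrite !(@gtr0_norm _ _^-1) ?invr_gt0//.
have h1 : `|x - x'| * y^-1 <= `|x - x'| * ym^-1 by rewrite ler_wpM2l.
have h2 : `|y - y'| * (x' * (y^-1 * y'^-1)) <= `|y - y'| * (xp / ym ^+ 2).
  rewrite ler_wpM2l// ler_pM ?(ltW x'0) ?mulr_ge0 ?invr_ge0 ?(ltW y0) ?(ltW y'0)//.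
  by rewrite expr2 invfM ler_pM ?invr_ge0 ?(ltW y0) ?(ltW y'0).
have h3 : 0 <= `|x - x'| * (xp / ym ^+ 2).
  by rewrite mulr_ge0// divr_ge0 ?sqr_ge0 ?ltW.
have h4 : 0 <= `|y - y'| * ym^-1 by rewrite mulr_ge0// invr_ge0 ltW.
by lra.
Qed.

Lemma sqrt_prod_lipschitz (R : realType) (xm xp ym yp : R) :
  0 < xm <= xp -> 0 < ym <= yp ->
  exists L B : R, [/\ 0 <= L, 0 <= B & forall x x' y y',
    xm <= x <= xp -> xm <= x' <= xp -> ym <= y <= yp -> ym <= y' <= yp ->
    Num.sqrt (x * y) <= B /\
    `|Num.sqrt (x * y) - Num.sqrt (x' * y')| <= L * (`|x - x'| + `|y - y'|)].
Proof.
move=> /andP[xm0 xmp] /andP[ym0 ymp].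
have xp0 := lt_le_trans xm0 xmp; have yp0 := lt_le_trans ym0 ymp.
pose s := (Num.sqrt (xm * ym))^-1.
have s0 : 0 <= s by rewrite invr_ge0 sqrtr_ge0.
exists (s * (xp + yp)), (Num.sqrt (xp * yp)); split.
- by rewrite mulr_ge0// addr_ge0 ?ltW.
- exact: sqrtr_ge0.
move=> x x' y y' /andP[x1 x2] /andP[x'1 x'2] /andP[y1 y2] /andP[y'1 y'2].
have y0 := lt_le_trans ym0 y1; have x'0 := lt_le_trans xm0 x'1.
have x0 := lt_le_trans xm0 x1.
split; first by apply: ler_wsqrtr; rewrite ler_pM ?(ltW x0) ?(ltW y0).
have lo u v : xm <= u -> ym <= v -> xm * ym <= u * v.
  by move=> xu yv; rewrite ler_pM ?(ltW xm0) ?(ltW ym0).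
apply: le_trans (sqrt_lipschitz (mulr_gt0 xm0 ym0) (lo _ _ x1 y1) (lo _ _ x'1 y'1)) _.
rewrite -mulrA ler_wpM2l//.
have -> : x * y - x' * y' = (x - x') * y + x' * (y - y') by ring.
rewrite (le_trans (ler_normD _ _))// !normrM (gtr0_norm x'0) (gtr0_norm y0).
have h1 : `|x - x'| * y <= `|x - x'| * yp by rewrite ler_wpM2l.
have h2 : x' * `|y - y'| <= xp * `|y - y'| by rewrite ler_wpM2r.
have h3 : 0 <= `|x - x'| * xp by rewrite mulr_ge0 ?(ltW xp0).
have h4 : 0 <= `|y - y'| * yp by rewrite mulr_ge0 ?(ltW yp0).
by lra.
Qed.

Lemma pi_gt2 (R : realType) : 2 < pi :> R.
Proof.
rewrite lt_neqAle pi_ge2 andbT; apply/eqP => h.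
have := @cos_pihalf R; rewrite -h divff// => c1.
by have := @cos1_gt0 R; rewrite c1 ltxx.
Qed.

Lemma sqrt_2_pi_le1 (R : realType) : 0 <= Num.sqrt (2 / (pi : R)) <= 1.
Proof.
rewrite sqrtr_ge0 -[leRHS]sqrtr1 ler_wsqrtr//.
by rewrite ler_pdivrMr ?pi_gt0// mul1r pi_ge2.
Qed.

Lemma bm_eff_rate (R : realType) (delta rm t : R) (gamma r n : R -> R) :
  0 < rm -> bounded_measurable t gamma ->
  bounded_measurable t r -> bounded_measurable t n ->
  (forall s, 0 <= s <= t -> rm <= r s) ->
  bounded_measurable t (eff_rate delta gamma r n).
Proof.
move=> rm0 bg br bn hr; apply: bmM => //; apply: bmD; first exact: bm_cst.
apply: bmM; first exact: bm_cst.
apply: bm_sqrt; apply: bmM => //; apply: (bmV (c := 2 * rm)); first by rewrite mulr_gt0.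
  by move=> s st; rewrite ler_pM2l// hr.
by apply: bmM => //; exact: bm_cst.
Qed.

Lemma bm_forcing_adv (R : realType) (delta t : R) (r n : R -> R) :
  bounded_measurable t r -> bounded_measurable t n ->
  bounded_measurable t (fun s => forcing_adv delta (r s) (n s)).
Proof.
move=> br bn; have b2r := bmM (bm_cst t 2) br.
apply: bmD; last by apply: bmM => //; exact: bm_cst.
apply: bmD => //; apply: bmM; first exact: bm_cst.
by apply: bm_sqrt; exact: bmM.
Qed.

Lemma bm_forcing_reg (R : realType) (delta t : R) (r n : R -> R) :
  bounded_measurable t r -> bounded_measurable t n ->
  bounded_measurable t (fun s => forcing_reg delta (r s) (n s)).
Proof.
move=> br bn; have b2r := bmM (bm_cst t 2) br.
apply: bmD; last by apply: bmM => //; exact: bm_cst.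
apply: bmD => //; apply: bmM; first exact: bm_cst.
by apply: bm_sqrt; exact: bmM.
Qed.

Lemma eff_rate_regE (R : realType) (delta : R) (gamma r n : R -> R) (t : R) :
  0 <= delta ->
  eff_rate delta gamma r n t * eff_reg delta r n t =
  gamma t * (delta ^+ 2 + delta * Num.sqrt (2 / pi) * Num.sqrt (2 * r t / n t)).
Proof.
move=> d0; rewrite /eff_rate /eff_reg -mulrA; congr (_ * _).
rewrite mulrC divfK// gt_eqF// ltr_pwDl//.
by rewrite !mulr_ge0 ?sqrtr_ge0.
Qed.

Lemma rates_lipschitz (R : realType) (gb rm rp nm np : R) :
  0 <= gb -> 0 < rm <= rp -> 0 < nm <= np ->
  exists L A B : R, [/\ 0 <= L, 0 <= A, 0 <= B &
  forall (delta : R) (gamma r n r' n' : R -> R) (t : R), 0 < delta <= 1 ->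
    0 <= gamma t <= gb -> rm <= r t <= rp -> rm <= r' t <= rp ->
    nm <= n t <= np -> nm <= n' t <= np ->
    let a := eff_rate delta gamma r n t in
    let a' := eff_rate delta gamma r' n' t in
    let b := eff_rate delta gamma r n t * eff_reg delta r n t in
    let b' := eff_rate delta gamma r' n' t * eff_reg delta r' n' t in
    let D := `|r t - r' t| + `|n t - n' t| in
    [/\ 0 <= a <= A, 0 <= b, `|a - a'| <= L * D & `|b - b'| <= L * D] /\
    (`|gamma t ^+ 2 * forcing_reg delta (r t) (n t)| <= B /\
     `|gamma t ^+ 2 * forcing_adv delta (r t) (n t) -
        gamma t ^+ 2 * forcing_reg delta (r' t) (n' t)| <=
      L * D + gb ^+ 2 * np * (delta ^+ 2 * (2^-1 - pi^-1)))].
Proof.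
move=> gb0 /andP[rm0 rmp] /andP[nm0 nmp].
have rp0 := lt_le_trans rm0 rmp; have np0 := lt_le_trans nm0 nmp.
have hn : 0 < nm <= np by rewrite nm0.
have h2r : 0 < 2 * rm <= 2 * rp by rewrite mulr_gt0//= ler_pM2l.
have [L1 [B1 [L10 B10 H1]]] := sqrt_ratio_lipschitz hn h2r.
have [L2 [B2 [L20 B20 H2]]] := sqrt_ratio_lipschitz h2r hn.
have [L3 [B3 [L30 B30 H3]]] := sqrt_prod_lipschitz h2r hn.
have gb20 : 0 <= gb ^+ 2 by exact: sqr_ge0.
exists (2 * gb * (L1 + L2) + gb ^+ 2 * (1 + 2 * L3)), (gb * (1 + B1)),
  (gb ^+ 2 * (rp + B3 + np)); split.
- by rewrite !(addr_ge0, mulr_ge0).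
- by rewrite !(addr_ge0, mulr_ge0).
- by rewrite !(addr_ge0, mulr_ge0)// ltW.
move=> delta gamma r n r' n' t /andP[d0 d1] /andP[g0 gB] hr hr' hnn hnn'.
have h2 x : rm <= x <= rp -> 2 * rm <= 2 * x <= 2 * rp.
  by move=> /andP[x1 x2]; rewrite !ler_pM2l// x1.
have [S1 E1] := H1 _ _ _ _ hnn hnn' (h2 _ hr) (h2 _ hr').
have [S2 E2] := H2 _ _ _ _ (h2 _ hr) (h2 _ hr') hnn hnn'.
have [S3 E3] := H3 _ _ _ _ (h2 _ hr) (h2 _ hr') hnn hnn'.
rewrite !eff_rate_regE ?(ltW d0)// /eff_rate.
have /andP[c0 c1] := sqrt_2_pi_le1 R.
set c := Num.sqrt (2 / pi) in c0 c1 *.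
set s1 := Num.sqrt (n t / (2 * r t)) in S1 E1 *.
set s2 := Num.sqrt (2 * r t / n t) in S2 E2 *.
set s3 := Num.sqrt (2 * r t * n t) in S3 E3.
set s1' := Num.sqrt (n' t / (2 * r' t)) in E1 *.
set s2' := Num.sqrt (2 * r' t / n' t) in E2 *.
set s3' := Num.sqrt (2 * r' t * n' t) in E3.
have s10 : 0 <= s1 by exact: sqrtr_ge0.
have s20 : 0 <= s2 by exact: sqrtr_ge0.
have s30 : 0 <= s3 by exact: sqrtr_ge0.
have dc0 : 0 <= delta * c by rewrite mulr_ge0// ltW.
have dc1 : delta * c <= 1 by rewrite mulr_ile1// ltW.
set D := `|r t - r' t| + `|n t - n' t|.
have D0 : 0 <= D by rewrite addr_ge0.
have dr : `|r t - r' t| <= D by rewrite lerDl.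
have dn : `|n t - n' t| <= D by rewrite lerDr.
have rr2 : `|2 * r t - 2 * r' t| = 2 * `|r t - r' t|.
  by rewrite -mulrBr normrM ger0_norm.
have F1 : `|s1 - s1'| <= L1 * (2 * D).
  by apply: le_trans E1 _; rewrite ler_wpM2l// rr2 /D; have := normr_ge0 (n t - n' t); lra.
have F2 : `|s2 - s2'| <= L2 * (2 * D).
  by apply: le_trans E2 _; rewrite ler_wpM2l// rr2 /D; have := normr_ge0 (n t - n' t); lra.
have F3 : `|s3 - s3'| <= L3 * (2 * D).
  by apply: le_trans E3 _; rewrite ler_wpM2l// rr2 /D; have := normr_ge0 (n t - n' t); lra.
have L1D : 0 <= gb * L1 * D by rewrite !mulr_ge0.
have L2D : 0 <= gb * L2 * D by rewrite !mulr_ge0.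
have L3D : 0 <= gb ^+ 2 * (1 + 2 * L3) * D by rewrite !(addr_ge0, mulr_ge0).
have dcle x : 0 <= x -> delta * c * x <= x by move=> x0; rewrite ler_piMl.
have /andP[r1 r2] := hr; have /andP[n1 n2] := hnn.
have r0 := lt_le_trans rm0 r1; have n0 := lt_le_trans nm0 n1.
have pi0 := pi_gt0 R.
have dsq : 0 <= delta ^+ 2 <= 1 by rewrite sqr_ge0 expr_le1// ltW.
have /andP[dsq0 dsq1] := dsq.
have ipi : 0 <= (pi : R)^-1 <= 1.
  by rewrite invr_ge0 (ltW pi0) invf_le1// (le_trans _ (pi_ge2 R))// ler1n.
have /andP[ipi0 ipi1] := ipi.
have dpi0 : 0 <= delta ^+ 2 / pi by rewrite mulr_ge0.
have dpi1 : delta ^+ 2 / pi <= 1 by rewrite mulr_ile1.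
have g2 : gamma t ^+ 2 <= gb ^+ 2 by rewrite lerXn2r// nnegrE.
have g20 : 0 <= gamma t ^+ 2 by exact: sqr_ge0.
split; split.
- apply/andP; split; first by rewrite mulr_ge0// addr_ge0// mulr_ge0.
  apply: ler_pM => //; first by rewrite addr_ge0// mulr_ge0.
  rewrite lerD2l; exact: le_trans (dcle _ s10) S1.
- by rewrite mulr_ge0// addr_ge0// mulr_ge0.
- rewrite -mulrBr (_ : _ - _ = delta * c * (s1 - s1')); last by ring.
  rewrite normrM (ger0_norm g0) normrM (ger0_norm dc0).
  apply: (@le_trans _ _ (gb * (L1 * (2 * D)))); last by lra.
  apply: ler_pM => //; first by rewrite mulr_ge0.
  exact: le_trans (dcle _ (normr_ge0 _)) F1.
- rewrite -mulrBr (_ : _ - _ = delta * c * (s2 - s2')); last by ring.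
  rewrite normrM (ger0_norm g0) normrM (ger0_norm dc0).
  apply: (@le_trans _ _ (gb * (L2 * (2 * D)))); last by lra.
  apply: ler_pM => //; first by rewrite mulr_ge0.
  exact: le_trans (dcle _ (normr_ge0 _)) F2.
- have f0 : 0 <= forcing_reg delta (r t) (n t).
    by rewrite /forcing_reg !addr_ge0 ?mulr_ge0 ?(ltW r0) ?(ltW n0) ?sqrtr_ge0 ?(ltW d0).
  rewrite ger0_norm ?mulr_ge0// ler_pM// /forcing_reg -/c -/s3 !lerD//.
    exact: le_trans (dcle _ s30) S3.
  by rewrite (le_trans _ n2)// ler_piMl// ltW.
rewrite -mulrBr /forcing_adv /forcing_reg -/c -/s3 -/s3'.
rewrite normrM (ger0_norm g20).
have eps0 : 0 <= delta ^+ 2 * (2^-1 - pi^-1).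
  by rewrite mulr_ge0// subr_ge0 lef_pV2 ?posrE// pi_ge2.
apply: (@le_trans _ _ (gb ^+ 2 * ((1 + 2 * L3) * D + np * (delta ^+ 2 * (2^-1 - pi^-1))))).
  rewrite ler_pM//.
  rewrite (_ : _ - _ = (r t - r' t) + delta * c * (s3 - s3') +
    delta ^+ 2 / pi * (n t - n' t) + n t * (delta ^+ 2 * (2^-1 - pi^-1))); last by ring.
  rewrite (le_trans (ler_normD _ _))// lerD//; last first.
    by rewrite normrM (gtr0_norm n0) (ger0_norm eps0) ler_wpM2r.
  rewrite (le_trans (ler_normD _ _))//.
  have q1 : `|r t - r' t + delta * c * (s3 - s3')| <= `|r t - r' t| + L3 * (2 * D).
    rewrite (le_trans (ler_normD _ _))// lerD2l normrM (ger0_norm dc0).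
    exact: le_trans (dcle _ (normr_ge0 _)) F3.
  have q2 : `|delta ^+ 2 / pi * (n t - n' t)| <= `|n t - n' t|.
    by rewrite normrM (ger0_norm dpi0) ler_piMl.
  by rewrite mulrDl mul1r {1}/D; lra.
by lra.
Qed.

(** * Comparison of the two systems *)

Lemma nonneg_rates_le (R : realType) (T t A : R) (a b : R -> R) :
  t <= T -> nonneg_rates T A a b -> nonneg_rates t A a b.
Proof.
move=> tT [ba bb aA b0]; split; [exact: bm_le ba|exact: bm_le bb|..];
  by move=> u /andP[u0 ut]; rewrite ?aA ?b0// u0 (le_trans ut).
Qed.

Lemma trace_decay (R : realType) (m d : nat) (K : 'M[R]_d) (W : 'M[R]_(m, d))
    (k : 'rV[R]_m) (delta : R) (gamma r n : R -> R) (t s : R)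
    (a := eff_rate delta gamma r n)
    (b := fun s => eff_rate delta gamma r n s * eff_reg delta r n s) :
  eigenframe K W k ->
  \tr (K *m decay K delta gamma r n t s) = \sum_j (\sum_i W j i ^+ 2) *
    (k 0 j * mode_decay a b (k 0 j) t s ^+ 2) /\
  \tr (K ^+ 2 *m decay K delta gamma r n t s) = \sum_j (\sum_i W j i ^+ 2) *
    (k 0 j ^+ 2 * mode_decay a b (k 0 j) t s ^+ 2).
Proof.
move=> fK; rewrite (decay_fcalc _ _ _ _ _ _ fK); split.
  by rewrite {1}(fcalc_id fK) (fcalcM _ _ fK) trace_fcalc.
by rewrite {1}(fcalc_id fK) (fcalc_expr _ _ fK) (fcalcM _ _ fK) trace_fcalc.
Qed.

Lemma initial_bound (R : realType) (m d : nat) (K : 'M[R]_d) (W : 'M[R]_(m, d))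
    (k : 'rV[R]_m) (X0 Xstar : 'cV[R]_d) (delta eta kap rp np : R)
    (gamma r n : R -> R) (T : R) (F : R -> R -> R) :
  eigenframe K W k -> (forall j, 0 <= k 0 j <= kap) -> 0 <= kap -> 0 <= T ->
  volterra_solution K X0 Xstar delta eta gamma T F r n ->
  bounded_measurable 0 (eff_rate delta gamma r n) ->
  bounded_measurable 0 (fun s => eff_rate delta gamma r n s * eff_reg delta r n s) ->
  r 0 <= rp -> n 0 <= np ->
  enorm X0 ^+ 2 + qform K Xstar <= np + (4 * rp + 2 * kap * np).
Proof.
move=> fK k0 kap0 T0 sol ba bb rrp nnp; have WW := frame_isometry fK.
have T00 : (0 : R) <= 0 <= T by rewrite lexx.
have mE j : (W *m mean_iterate K X0 Xstar delta gamma r n 0) j 0 = (W *m X0) j 0.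
  rewrite (mean_iterate_mode _ _ _ fK ba bb) /mode_decay /mode_forcing !integral0_at0.
  by rewrite !(subrr, mulr0, oppr0, addr0) expR0; ring.
have n0 := volterra_eq_n sol T00; have r0 := volterra_eq_r sol T00.
rewrite integral0_at0 mulr0 addr0 in n0; rewrite integral0_at0 mulr0 addr0 in r0.
have hn : enorm X0 ^+ 2 <= np.
  rewrite -(_ : n 0 = enorm X0 ^+ 2)// n0 !(enorm_frame _ WW).
  by apply: eq_bigr => j _; rewrite mE.
have hx : qform K X0 <= kap * enorm X0 ^+ 2.
  rewrite (qform_frame _ fK) (enorm_frame _ WW) mulr_sumr ler_sum// => j _.
  by rewrite ler_wpM2r ?sqr_ge0//; have /andP[] := k0 j.
have hr : qform K (X0 - Xstar) <= 2 * rp.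
  have -> : qform K (X0 - Xstar) =
      qform K (mean_iterate K X0 Xstar delta gamma r n 0 - Xstar).
    rewrite !(qform_frame _ fK); apply: eq_bigr => j _.
    by rewrite !mulmxBr mxE [in RHS]mxE mE.
  by have := sqr_ge0 eta; lra.
have hs : qform K Xstar <= 2 * qform K (X0 - Xstar) + 2 * qform K X0.
  rewrite !(qform_frame _ fK) !mulr_sumr -big_split ler_sum// => j _ /=.
  rewrite mulmxBr [in X in _ <= _ * (_ * X) + _]mxE [in X in _ <= _ * (_ * (_ + X) ^+ 2) + _]mxE.
  have /andP[kj0 _] := k0 j; set x := (W *m X0) j 0; set y := (W *m Xstar) j 0.
  have : 0 <= k 0 j * (2 * x - y) ^+ 2 by rewrite mulr_ge0 ?sqr_ge0.
  by lra.
have hk : kap * enorm X0 ^+ 2 <= kap * np by rewrite ler_wpM2l.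
by lra.
Qed.

Lemma dist_half_sum (R : realType) (q q' c i i' : R) :
  `|2^-1 * q + c + i - (2^-1 * q' + c + i')| <= 2^-1 * `|q - q'| + `|i - i'|.
Proof.
rewrite (_ : _ - _ = 2^-1 * (q - q') + (i - i')); last by ring.
by rewrite (le_trans (ler_normD _ _))// lerD2r normrM ger0_norm// invr_ge0.
Qed.

Lemma dist_double_sum (R : realType) (x q q' i i' : R) :
  `|q + 2 / x * i - (q' + 2 / x * i')| <= `|q - q'| + 2 * `|x^-1 * i - x^-1 * i'|.
Proof.
rewrite (_ : _ - _ = q - q' + 2 * (x^-1 * i - x^-1 * i')); last by ring.
by rewrite (le_trans (ler_normD _ _))// lerD2l normrM ger0_norm.
Qed.

Lemma gronwall_coefficients (R : realType) (x y p p' M S k v w eps E : R) :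
  0 <= E -> 0 <= p' * (M * E) * S ->
  x <= 2^-1 * (p' * (M * E) * S) + k ^+ 2 * (v * E + w * eps) ->
  y <= p * (M * E) * S + 2 * (k * (v * E + w * eps)) ->
  x + y <= (k ^+ 2 + 2 * k) * w * eps +
    ((p + p') * M * S + (k ^+ 2 + 2 * k) * v + 1) * E.
Proof. by move=> E0 h0 hx hy; lra. Qed.

Lemma volterra_stability (R : realType) (kap gb T rm rp nm np : R) :
  0 <= kap -> 0 <= gb -> 0 <= T -> 0 < rm <= rp -> 0 < nm <= np ->
  exists2 C : R, 0 <= C &
  forall (d : nat) (K : 'M[R]_d) (X0 Xstar : 'cV[R]_d) (delta eta : R)
    (gamma r n r' n' : R -> R),
    (0 < d)%N -> sym_psd K -> opnorm K <= kap -> 0 < delta <= 1 ->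
    {within `[0, +oo[, continuous gamma} ->
    (forall t, 0 <= t -> 0 <= gamma t <= gb) ->
    volterra_solution K X0 Xstar delta eta gamma T (forcing_adv delta) r n ->
    volterra_solution K X0 Xstar delta eta gamma T (forcing_reg delta) r' n' ->
    (forall t, 0 <= t <= T -> (rm <= r t <= rp) /\ (rm <= r' t <= rp)) ->
    (forall t, 0 <= t <= T -> (nm <= n t <= np) /\ (nm <= n' t <= np)) ->
    forall t, 0 <= t <= T ->
      `|r t - r' t| + `|n t - n' t| <= C * (delta ^+ 2 * (2^-1 - pi^-1)).
Proof.
move=> kap0 gb0 T0 hrr hnn.
have [L [A [B [L0 A0 B0 rates]]]] := rates_lipschitz gb0 hrr hnn.
have [rm0 rmp] := andP hrr; have [nm0 nmp] := andP hnn.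
have rp0 := lt_le_trans rm0 rmp; have np0 := lt_le_trans nm0 nmp.
pose S := np + (4 * rp + 2 * kap * np).
pose M := L * ((kap + 1) + 1 + A * (kap + 1) * T).
pose P := 4 * (1 + A * T) * (1 + kap).
pose P' := 4 * (1 + A * T) * (1 + kap) ^+ 2 + 3 * (1 + kap).
pose Ca := (P + P') * M * S + (kap ^+ 2 + 2 * kap) * (L + 2 * B * (kap + 1) * L * T).
pose Cb := (kap ^+ 2 + 2 * kap) * (gb ^+ 2 * np * T).
have k10 : 0 <= kap + 1 by exact: addr_ge0.
have k1'0 : 0 <= 1 + kap by exact: addr_ge0.
have S0 : 0 <= S by rewrite !(addr_ge0, mulr_ge0) ?(ltW np0) ?(ltW rp0).
have M0 : 0 <= M by rewrite !(addr_ge0, mulr_ge0).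
have P0 : 0 <= P by rewrite !(addr_ge0, mulr_ge0).
have P'0 : 0 <= P' by rewrite !(addr_ge0, mulr_ge0)// exprn_ge0.
have kk0 : 0 <= kap ^+ 2 + 2 * kap by rewrite addr_ge0 ?sqr_ge0 ?mulr_ge0.
have Ca0 : 0 <= Ca.
  apply: addr_ge0; first exact: mulr_ge0 (mulr_ge0 (addr_ge0 P0 P'0) M0) S0.
  by apply: mulr_ge0 => //; rewrite addr_ge0// !mulr_ge0.
have Cb0 : 0 <= Cb by rewrite !mulr_ge0 ?sqr_ge0 ?(ltW np0).
exists (2 * Cb * expR (2 * (Ca + 1) * T)).
  exact: mulr_ge0 (mulr_ge0 (ler0n _ 2) Cb0) (expR_ge0 _).
move=> d K X0 Xstar delta eta gamma r n r' n' d0 Kpsd Kop dlt cg hg sol sol' hr hn.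
have [m [W [k [fK kop]]]] := psd_eigenframe Kpsd.
have k0 j : 0 <= k 0 j <= kap.
  by have /andP[k1 k2] := kop j; rewrite k1 (le_trans k2).
have WW := frame_isometry fK.
set eps := delta ^+ 2 * _.
have eps0 : 0 <= eps.
  by rewrite mulr_ge0 ?sqr_ge0// subr_ge0 lef_pV2 ?posrE ?pi_gt0// pi_ge2.
have bg : bounded_measurable T gamma.
  split; last by exists gb => s /andP[s0 _]; have /andP[g0 g1] := hg s s0; rewrite ger0_norm.
  apply: subspace_continuous_measurable_fun => //.
  by apply: continuous_subspaceW cg => s /=; rewrite !in_itv/= andbT => /andP[].
have bms (lo hi : R) (f : R -> R) : 0 < lo -> measurable_fun `[0, T] f ->
    (forall t, 0 <= t <= T -> lo <= f t <= hi) -> bounded_measurable T f.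
  move=> lo0 mf fb; split=> //; exists hi => s /fb/andP[f1 f2].
  by rewrite ger0_norm// ltW// (lt_le_trans lo0).
have hr1 t : 0 <= t <= T -> rm <= r t <= rp by case/hr.
have hr2 t : 0 <= t <= T -> rm <= r' t <= rp by case/hr.
have hn1 t : 0 <= t <= T -> nm <= n t <= np by case/hn.
have hn2 t : 0 <= t <= T -> nm <= n' t <= np by case/hn.
have br := bms _ _ _ rm0 (volterra_meas_r sol) hr1.
have br' := bms _ _ _ rm0 (volterra_meas_r sol') hr2.
have bn := bms _ _ _ nm0 (volterra_meas_n sol) hn1.
have bn' := bms _ _ _ nm0 (volterra_meas_n sol') hn2.
pose a := eff_rate delta gamma r n.
pose b := fun s => eff_rate delta gamma r n s * eff_reg delta r n s.
pose a' := eff_rate delta gamma r' n'.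
pose b' := fun s => eff_rate delta gamma r' n' s * eff_reg delta r' n' s.
pose D := fun s => `|r s - r' s| + `|n s - n' s|.
have D0 s : 0 <= D s by rewrite addr_ge0.
have bD : bounded_measurable T D by apply: bmD; apply: bm_norm; exact: bmB.
have hgT s : 0 <= s <= T -> 0 <= gamma s <= gb by move=> /andP[s0 _]; exact: hg.
have rate s (sT : 0 <= s <= T) :=
  rates delta gamma r n r' n' s dlt (hgT _ sT) (hr1 _ sT) (hr2 _ sT) (hn1 _ sT) (hn2 _ sT).
have rate' s (sT : 0 <= s <= T) :=
  rates delta gamma r' n' r' n' s dlt (hgT _ sT) (hr2 _ sT) (hr2 _ sT) (hn2 _ sT) (hn2 _ sT).
have bmreg rho nu : bounded_measurable T rho -> bounded_measurable T nu ->
    (forall t, 0 <= t <= T -> rm <= rho t <= rp) ->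
    (forall t, 0 <= t <= T -> nm <= nu t <= np) ->
    bounded_measurable T (eff_rate delta gamma rho nu) /\
    bounded_measurable T (fun s => eff_rate delta gamma rho nu s * eff_reg delta rho nu s).
  move=> bmr bmn rhoT nuT.
  have ba : bounded_measurable T (eff_rate delta gamma rho nu).
    by apply: (bm_eff_rate _ rm0) => // s /rhoT/andP[].
  split=> //; apply: bmM => //; apply: bmM.
    apply: bmD; first exact: bm_cst.
    apply: bmM; first exact: bm_cst.
    apply: bm_sqrt; apply: bmM; first by apply: bmM => //; exact: bm_cst.
    by apply: (bmV nm0) => // s /nuT/andP[].
  apply: (bmV (c := 1)) => //.
    move=> s _; rewrite lerDl !mulr_ge0 ?sqrtr_ge0//.
    by case/andP: dlt => /ltW.
  apply: bmD; first exact: bm_cst.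
  apply: bmM; first exact: bm_cst.
  apply: bm_sqrt; apply: bmM => //; apply: (bmV (c := 2 * rm)).
  - by rewrite mulr_gt0.
  - by move=> s /rhoT/andP[h _]; rewrite ler_pM2l.
  - by apply: bmM => //; exact: bm_cst.
have [ba bb] := bmreg _ _ br bn hr1 hn1; have [ba' bb'] := bmreg _ _ br' bn' hr2 hn2.
have NR : nonneg_rates T A a b.
  by split=> // s sT; have [[]] := rate s sT.
have NR' : nonneg_rates T A a' b'.
  by split=> // s sT; have [[]] := rate' s sT.
have T00 : (0 : R) <= 0 <= T by rewrite lexx.
have SX : enorm X0 ^+ 2 + qform K Xstar <= S.
  apply: (initial_bound fK k0 kap0 T0 sol).
  - exact: bm_le ba.
  - exact: bm_le bb.
  - by have /andP[] := hr1 _ T00.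
  - by have /andP[] := hn1 _ T00.
have key t : 0 <= t <= T -> D t <= Cb * eps + (Ca + 1) * integral0 D t.
  move=> tT; have /andP[t0 tT'] := tT.
  have inT u : 0 <= u <= t -> 0 <= u <= T.
    by move=> /andP[u0 ut]; rewrite u0 (le_trans ut).
  have NRt := nonneg_rates_le tT' NR; have NRt' := nonneg_rates_le tT' NR'.
  have bDt := bm_le tT' bD.
  have E0 : 0 <= integral0 D t by apply: Rintegral_ge0 => u _; exact: D0.
  set E := integral0 D t in E0 *.
  have bLD : bounded_measurable t (fun u => L * D u) by apply: bmM => //; exact: bm_cst.
  have ea : integral0 (fun u => `|a u - a' u|) t <= L * E.
    rewrite -integral0Z//; apply: le_integral0 => //.
      by apply: bm_norm; apply: bm_le tT' _; exact: bmB.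
    by move=> u /inT uT; have [[]] := rate u uT.
  have eb : integral0 (fun u => `|b u - b' u|) t <= L * E.
    rewrite -integral0Z//; apply: le_integral0 => //.
      by apply: bm_norm; apply: bm_le tT' _; exact: bmB.
    by move=> u /inT uT; have [[]] := rate u uT.
  have [mn mr] := mean_terms_lipschitz fK k0 NRt NRt' ea eb t0
    (fun j => mean_iterate_mode X0 Xstar j fK (bm_le tT' ba) (bm_le tT' bb))
    (fun j => mean_iterate_mode X0 Xstar j fK (bm_le tT' ba') (bm_le tT' bb')).
  pose f s := gamma s ^+ 2 * forcing_adv delta (r s) (n s).
  pose f' s := gamma s ^+ 2 * forcing_reg delta (r' s) (n' s).
  pose h s := L * D s + gb ^+ 2 * np * eps.
  have bg2 : bounded_measurable T (fun s => gamma s ^+ 2) by exact: bmM.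
  have bf : bounded_measurable t f.
    by apply: bm_le tT' _; apply: bmM => //; exact: bm_forcing_adv.
  have bf' : bounded_measurable t f'.
    by apply: bm_le tT' _; apply: bmM => //; exact: bm_forcing_reg.
  have bh : bounded_measurable t h by apply: bmD => //; exact: bm_cst.
  have fB u : 0 <= u <= t -> `|f' u| <= B by move=> /inT uT; have [_ []] := rate' u uT.
  have fh u : 0 <= u <= t -> `|f u - f' u| <= h u by move=> /inT uT; have [_ []] := rate u uT.
  have l1 j : 0 <= k 0 j <= kap by [].
  have l2 j : 0 <= k 0 j ^+ 2 <= kap ^+ 2.
    by have /andP[k1 k2] := k0 j; rewrite sqr_ge0 lerXn2r// nnegrE.
  have v1 := volterra_term_lipschitz d0 WW l1 k0 NRt NRt' ea eb t0 bf bf' bh fB fh.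
  have v2 := volterra_term_lipschitz d0 WW l2 k0 NRt NRt' ea eb t0 bf bf' bh fB fh.
  have hE : integral0 h t + 2 * B * (kap + 1) * (L * E) * t <=
      (L + 2 * B * (kap + 1) * L * T) * E + gb ^+ 2 * np * T * eps.
    rewrite integral0D//; last exact: bm_cst.
    rewrite integral0Z// integral0_cst// -/E.
    have i1 : 2 * B * (kap + 1) * (L * E) * t <= 2 * B * (kap + 1) * (L * E) * T.
      by rewrite ler_wpM2l// !mulr_ge0.
    have i2 : gb ^+ 2 * np * eps * t <= gb ^+ 2 * np * eps * T.
      exact: ler_wpM2l (mulr_ge0 (mulr_ge0 (sqr_ge0 gb) (ltW np0)) eps0) _ _ tT'.
    by lra.
  set e1 := (kap + 1) * (L * E) + L * E + A * ((kap + 1) * (L * E)) * t in mn mr.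
  have e10 : 0 <= e1 by rewrite !(addr_ge0, mulr_ge0).
  have e1M : e1 <= M * E.
    have : A * ((kap + 1) * (L * E)) * t <= A * ((kap + 1) * (L * E)) * T.
      by rewrite ler_wpM2l// !mulr_ge0.
    by rewrite /e1 /M; lra.
  have At : 1 + A * t <= 1 + A * T by rewrite lerD2l ler_wpM2l.
  have At0 : 0 <= 1 + A * t by rewrite !(addr_ge0, mulr_ge0).
  have SX0 : 0 <= enorm X0 ^+ 2 + qform K Xstar.
    by rewrite addr_ge0 ?sqr_ge0//; case: Kpsd.
  have pP : 4 * (1 + A * t) * (1 + kap) <= P by rewrite ler_wpM2r// ler_wpM2l.
  have pP' : 4 * (1 + A * t) * (1 + kap) ^+ 2 + 3 * (1 + kap) <= P'.
    by rewrite lerD2r ler_wpM2r ?sqr_ge0// ler_wpM2l.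
  have mono p p' : 0 <= p -> p <= p' ->
      p * e1 * (enorm X0 ^+ 2 + qform K Xstar) <= p' * (M * E) * S.
    by move=> p0 pp; apply: ler_pM => //; [exact: mulr_ge0 | exact: ler_pM].
  have {}mn := le_trans mn (mono _ _ (mulr_ge0 (mulr_ge0 (ler0n _ 4) At0) k1'0) pP).
  have {}mr := le_trans mr (mono _ _ (addr_ge0 (mulr_ge0 (mulr_ge0 (ler0n _ 4) At0)
    (sqr_ge0 _)) (mulr_ge0 (ler0n _ 3) k1'0)) pP').
  have {}v1 := le_trans v1 (ler_wpM2l kap0 hE).
  have {}v2 := le_trans v2 (ler_wpM2l (sqr_ge0 kap) hE).
  have trE rho nu (F : R -> R) :
      integral0 (fun s => F s * \tr (K *m decay K delta gamma rho nu t s)) t =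
      integral0 (fun s => F s * \sum_j (\sum_i W j i ^+ 2) * (k 0 j *
        mode_decay (eff_rate delta gamma rho nu) (fun s => eff_rate delta gamma rho nu s
          * eff_reg delta rho nu s) (k 0 j) t s ^+ 2)) t /\
      integral0 (fun s => F s * \tr (K ^+ 2 *m decay K delta gamma rho nu t s)) t =
      integral0 (fun s => F s * \sum_j (\sum_i W j i ^+ 2) * (k 0 j ^+ 2 *
        mode_decay (eff_rate delta gamma rho nu) (fun s => eff_rate delta gamma rho nu s
          * eff_reg delta rho nu s) (k 0 j) t s ^+ 2)) t.
    by split; apply: eq_integral0 => s _; have [E1 E2] := trace_decay delta gamma rho nu t s fK;
      rewrite ?E1 ?E2.
  have rE := volterra_eq_r sol tT; have rE' := volterra_eq_r sol' tT.
  have nE := volterra_eq_n sol tT; have nE' := volterra_eq_n sol' tT.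
  rewrite (proj2 (trE _ _ _)) -/a -/b in rE; rewrite (proj2 (trE _ _ _)) -/a' -/b' in rE'.
  rewrite (proj1 (trE _ _ _)) -/a -/b in nE; rewrite (proj1 (trE _ _ _)) -/a' -/b' in nE'.
  rewrite -/f in rE nE; rewrite -/f' in rE' nE'.
  have dr : `|r t - r' t| <= 2^-1 * (P' * (M * E) * S) + kap ^+ 2 *
     ((L + 2 * B * (kap + 1) * L * T) * E + gb ^+ 2 * np * T * eps).
    rewrite rE rE'; apply: le_trans (dist_half_sum _ _ _ _ _) _.
    by apply: lerD; [exact: ler_wpM2l | exact: v2].
  have dn : `|n t - n' t| <= P * (M * E) * S + 2 * (kap *
     ((L + 2 * B * (kap + 1) * L * T) * E + gb ^+ 2 * np * T * eps)).
    rewrite nE nE'; apply: le_trans (dist_double_sum _ _ _ _ _) _.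
    by apply: lerD; [exact: mn | exact: ler_wpM2l].
  apply: gronwall_coefficients dr dn => //.
  exact: mulr_ge0 (mulr_ge0 P'0 (mulr_ge0 M0 E0)) S0.
move=> t tT.
have := gronwall (ltr_wpDl Ca0 ltr01) (mulr_ge0 Cb0 eps0) bD (fun s _ => D0 s) key tT.
by rewrite /D mulrA mulrAC.
Qed.

Theorem proposition4p1 (R : realType) (kappa gammabar T rm rp nm np : R)
    (hT : 0 <= T) (hrm : 0 < rm) (hnm : 0 < nm) :
  exists C : R,
  forall (d : nat) (K : 'M[R]_d) (X0 Xstar : 'cV[R]_d)
    (delta eta : R) (gamma : R -> R) (r n r' n' : R -> R),
    (0 < d)%N ->
    sym_psd K -> opnorm K <= kappa ->
    0 < delta -> 0 <= eta ->
    {within `[0, +oo[, continuous gamma} ->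
    (forall t, 0 <= t -> 0 <= gamma t <= gammabar) ->
    volterra_solution K X0 Xstar delta eta gamma T (forcing_adv delta) r n ->
    volterra_solution K X0 Xstar delta eta gamma T (forcing_reg delta) r' n' ->
    r 0 = r' 0 -> n 0 = n' 0 ->
    (forall t, 0 <= t <= T -> (rm <= r t <= rp) /\ (rm <= r' t <= rp)) ->
    (forall t, 0 <= t <= T -> (nm <= n t <= np) /\ (nm <= n' t <= np)) ->
    (ereal_sup [set (`|r t - r' t| + `|n t - n' t|)%R%:E | t in `[0%R, T]]
       <= (C * delta ^+ 2 * (2^-1 - pi^-1))%R%:E)%E.
Proof.
have T00 : (0 : R) <= 0 <= T by rewrite lexx.
have [/and4P[kap0 gb0 hr hn]|H] :=
    boolP [&& 0 <= kappa, 0 <= gammabar, rm <= rp & nm <= np]; last first.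
  exists 0 => d K X0 Xstar delta eta gamma r n r' n' d0 Kpsd Kop _ _ _ hg _ _ _ _ hr hn.
  case/negP: H; apply/and4P; split.
  - have [m [W [k [fK kop]]]] := psd_eigenframe Kpsd.
    apply: le_trans Kop; case: m W k fK kop => [|m] W k fK kop; last first.
      by have /andP[k0 k1] := kop ord0; exact: le_trans k1.
    have := frame_weight (frame_isometry fK); rewrite big_ord0 => /esym/eqP.
    by rewrite pnatr_eq0 eqn0Ngt d0.
  - by have /andP[g0 g1] := hg 0 (lexx 0); exact: le_trans g1.
  - by have [/andP[h1 h2] _] := hr 0 T00; exact: le_trans h2.
  - by have [/andP[h1 h2] _] := hn 0 T00; exact: le_trans h2.
have [C C0 HC] : exists2 C : R, 0 <= C & _ :=
  volterra_stability (T := T) kap0 gb0 hT (introT andP (conj hrm hr)) (introT andP (conj hnm hn)).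
pose g : R := 2^-1 - pi^-1.
have g0 : 0 < g by rewrite subr_gt0 ltf_pV2 ?posrE ?pi_gt0// pi_gt2.
have rp0 := lt_le_trans hrm hr; have np0 := lt_le_trans hnm hn.
have Q0 : 0 <= (rp + np) / g.
  by apply: divr_ge0; [apply: addr_ge0; exact: ltW | exact: ltW].
exists (C + (rp + np) / g) => d K X0 Xstar delta eta gamma r n r' n'.
move=> d0 Kpsd Kop dl0 _ cg hg sol sol' _ _ hrT hnT.
apply: ge_ereal_sup => _ [t /= tT <-]; rewrite lee_fin.
rewrite in_itv/= in tT; rewrite -/g -mulrA.
have dg0 : 0 <= delta ^+ 2 * g by rewrite mulr_ge0 ?sqr_ge0// ltW.
have [d1|d1] := leP delta 1.
  apply: le_trans (HC _ _ _ _ _ _ _ _ _ _ _ d0 Kpsd Kop _ cg hg sol sol' hrT hnT t tT) _.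
    by rewrite dl0.
  by rewrite ler_wpM2r// lerDl.
have dist (lo hi x y : R) : 0 < lo -> lo <= x <= hi -> lo <= y <= hi -> `|x - y| <= hi.
  by move=> lo0 /andP[x1 x2] /andP[y1 y2]; rewrite ler_norml; apply/andP; split; lra.
apply: (@le_trans _ _ (rp + np)).
  have [r1 r2] := hrT t tT; have [n1 n2] := hnT t tT.
  by apply: lerD; [exact: dist hrm r1 r2 | exact: dist hnm n1 n2].
apply: (@le_trans _ _ ((rp + np) / g * g)); first by rewrite divfK// gt_eqF.
apply: ler_pM => //; first exact: ltW.
  by rewrite lerDr.
by rewrite ler_peMl ?(ltW g0)// expr_ge1// ltW.
Qed.
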